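(* For every $\varepsilon>0$ there exists $\delta>0$ satisfying the following condition. Let $A$ and $B$ be two C*-algebras, $(h_\lambda)_{\lambda\in\Lambda}$ an approximate unit of $A$, and $\varphi:A\to B$ a 2-positive linear contraction. If a positive contraction $a\in A$ satisfies $$\limsup_{\lambda}\left\lVert \varphi(a)^2-\varphi(a^2)\varphi(h_\lambda)\right\rVert<\delta,$$ then the weak*-limit $h_\varphi\in B^{**}$ of the net $(\varphi(h_\lambda))_{\lambda\in\Lambda}$ and $a$ satisfy $$\sup_{b\in A,\ \lVert b\rVert\le 1}\left\lVert \varphi(a)\varphi(b)-h_\varphi\varphi(ab)\right\rVert<\varepsilon.$$ Specifically, a 2-positive linear map $\varphi$ from a unital C*-algebra $A$ to a C*-algebra $B$ has order zero if $\varphi(a)^2=\varphi(a^2)\varphi(1_A)$ for every positive element $a\in A$.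
   Context: C*-algebras are not assumed unital unless stated. A linear map $\varphi:A\to B$ is positive if it maps positive elements to positive elements, and $k$-positive if $\varphi\otimes\mathrm{id}_{M_k}:A\otimes M_k\to B\otimes M_k$ is positive. A positive linear map $\varphi:A\to B$ has order zero if $\varphi(a)\varphi(b)=0$ for all positive $a,b\in A$ with $ab=0$. An approximate unit of $A$ is an increasing net $(h_\lambda)$ of positive contractions in $A$ with $\lim_\lambda\|h_\lambda a-a\|=0$ for all $a\in A$. $B$ is regarded as a C*-subalgebra of its second dual $B^{**}$; the weak*-limit $h_\varphi$ of $\varphi(h_\lambda)$ in $B^{**}$ exists because $(\varphi(h_\lambda))$ is bounded and increasing (and it does not depend on the choice of the approximate unit). *)

(* Defs.v *)
From HB Require Import structures.
From mathcomp Require Import all_boot all_order all_algebra.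
From mathcomp Require Import all_classical all_reals all_analysis.
From mathcomp Require Import complex.

Set Implicit Arguments.
Unset Strict Implicit.
Unset Printing Implicit Defensive.

Import Order.TTheory GRing.Theory Num.Theory.
Import numFieldNormedType.Exports.

Local Open Scope classical_set_scope.
Local Open Scope ring_scope.

(* Norms of modules over R[i] are R[i]-valued in the library (with a real
   nonnegative value); [rnorm] is the same number, seen in R. *)
Definition rnorm (R : realType) (V : normedModType R[i]) (x : V) : R :=
  complex.Re `|x|.

(* The library's rings all have a unit, so the product of a possibly nonunital
   C*-algebra is an operation of its own. *)
HB.mixin Record isCStarAlgebra (R : realType) A
    & CompleteNormedModule R[i] A := {
  cmul : A -> A -> A;
  cstar : A -> A;
  cmulA : associative cmul;
  cmulDl : left_distributive cmul +%R;
  cmulDr : right_distributive cmul +%R;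
  cscaleAl : forall (k : R[i]) (x y : A), k *: cmul x y = cmul (k *: x) y;
  cscaleAr : forall (k : R[i]) (x y : A), k *: cmul x y = cmul x (k *: y);
  cnormM : forall x y : A, `|cmul x y| <= `|x| * `|y|;
  cstarK : involutive cstar;
  cstarD : {morph cstar : x y / x + y};
  cstarZ : forall (k : R[i]) (x : A), cstar (k *: x) = (k^*)%C *: cstar x;
  cstarM : forall x y : A, cstar (cmul x y) = cmul (cstar y) (cstar x);
  cnorm_star : forall x : A, `|cmul (cstar x) x| = `|x| ^+ 2
}.

#[short(type="cstarAlgType")]
HB.structure Definition CStarAlgebra (R : realType) :=
  {A of CompleteNormedModule R[i] A & isCStarAlgebra R A}.

Notation "x ** y" := (cmul x y) (at level 40, left associativity) : ring_scope.

Section CStarNotions.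
Context {R : realType}.
Implicit Types A B : cstarAlgType R.

Definition is_unity A (e : A) := forall a : A, e ** a = a /\ a ** e = a.

Definition positive_elt A (a : A) := exists x : A, a = cstar x ** x.

(* A ⊗ M_k is identified with the *-algebra M_k(A) *)
Definition mxcmul A k (x y : 'M[A]_k) : 'M[A]_k :=
  \matrix_(i, j) \sum_(l < k) x i l ** y l j.

Definition mxcstar A k (x : 'M[A]_k) : 'M[A]_k :=
  \matrix_(i, j) cstar (x j i).

Definition mxpositive A k (a : 'M[A]_k) :=
  exists x : 'M[A]_k, a = mxcmul (mxcstar x) x.

Definition positive_map A B (phi : A -> B) :=
  forall a, positive_elt a -> positive_elt (phi a).

Definition k_positive k A B (phi : A -> B) :=
  forall a : 'M[A]_k, mxpositive a -> mxpositive (map_mx phi a).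

Definition contractive A B (phi : A -> B) :=
  forall a, rnorm (phi a) <= rnorm a.

Definition order_zero A B (phi : A -> B) :=
  positive_map phi /\
  forall a b, positive_elt a -> positive_elt b -> a ** b = 0 ->
    phi a ** phi b = 0.

End CStarNotions.

Section Nets.
Context {d : Order.disp_t} (L : preorderType d).

Definition directed :=
  (exists l : L, True) /\ forall l m : L, exists n, (l <= n)%O /\ (m <= n)%O.

Definition net_filter : set_system L :=
  filter_from setT (fun l => [set m | (l <= m)%O]).

Definition net_limsup (R : realType) (x : L -> R) : \bar R :=
  ereal_inf [set ereal_sup [set (x m)%:E | m in [set m | (l <= m)%O]]
            | l in setT].

End Nets.
Arguments net_filter {d} L.

Definition approximate_unit (R : realType) (A : cstarAlgType R)
    (d : Order.disp_t) (L : preorderType d) (h : L -> A) :=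
  [/\ directed L,
      forall l m, (l <= m)%O -> positive_elt (h m - h l),
      forall l, positive_elt (h l) /\ rnorm (h l) <= 1 &
      forall a, rnorm (h l ** a - a) @[l --> net_filter L] --> (0 : R)].

Section RealNorm.
Context {R : realType}.
Implicit Types V W : normedModType R[i].

Lemma rnormE V (x : V) : (rnorm x)%:C%C = `|x|.
Proof. by rewrite /rnorm complex.RRe_real// normr_real. Qed.

Lemma rnorm_ge0 V (x : V) : 0 <= rnorm x.
Proof. by rewrite -ler0c rnormE normr_ge0. Qed.

Lemma rnorm0_eq0 V (x : V) : rnorm x = 0 -> x = 0.
Proof. by move=> x0; apply/normr0_eq0; rewrite -rnormE x0 rmorph0. Qed.

Lemma rnormD V (x y : V) : rnorm (x + y) <= rnorm x + rnorm y.
Proof. by rewrite -lecR rmorphD/= !rnormE ler_normD. Qed.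

Lemma rnormZ V (k : R[i]) (x : V) :
  rnorm (k *: x) = rnorm (k : R[i]^o) * rnorm x.
Proof. by apply: complexI; rewrite rmorphM/= !rnormE normrZ. Qed.

Lemma rnorm0 V : rnorm (0 : V) = 0.
Proof. by apply: complexI; rewrite rnormE normr0 rmorph0. Qed.

Lemma linear_rbounded_continuous V W (f : {linear V -> W}) :
  continuous f <-> exists M, forall x, rnorm (f x) <= M * rnorm x.
Proof.
split=> [/linear_bounded_continuous/linear_boundedP/pinfty_ex_gt0|[M fM]].
  move=> [M M0 fM]; exists (complex.Re M) => x.
  by rewrite -lecR rmorphM/= !rnormE RRe_real// gtr0_real.
apply/linear_bounded_continuous/linear_boundedP.
exists M%:C%C; split; first by rewrite complex_real eqxx.
move=> r Mr x; rewrite -!rnormE (@le_trans _ _ (M%:C%C * (rnorm x)%:C%C))//.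
  by rewrite -rmorphM/= lecR.
by apply: ler_wpM2r; [rewrite ler0c rnorm_ge0|exact: ltW].
Qed.

End RealNorm.

Section Dual.
Context {R : realType} (V : normedModType R[i]).

Definition dual_pred : {pred V -> R[i]^o} :=
  fun f => `[< linear f /\ continuous f >].

Record dual := Dual {
  dual_fun :> V -> R[i]^o;
  dual_funP : dual_fun \in dual_pred }.

HB.instance Definition _ := [isSub for dual_fun].
HB.instance Definition _ := [Choice of dual by <:].

Lemma dual_predE f : (f \in dual_pred) = `[< linear f /\ continuous f >].
Proof. by []. Qed.

Lemma dual_predP (f : V -> R[i]^o) (fl : linear f) :
  (exists M, forall x, rnorm (f x) <= M * rnorm x) -> f \in dual_pred.
Proof.
pose L := GRing.isLinear.Build _ _ _ _ f fl.
pose g : {linear V -> R[i]^o} := HB.pack f L.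
move=> fM; rewrite dual_predE; apply/asboolP; split => //.
exact/(linear_rbounded_continuous g).
Qed.

Lemma dual_linear (f : dual) : linear f.
Proof. by case: f => f /= /asboolP[]. Qed.

HB.instance Definition _ (f : dual) :=
  GRing.isLinear.Build R[i] V R[i]^o _ (dual_fun f) (dual_linear f).

Lemma dual_bounded (f : dual) :
  exists M, forall x, rnorm (f x) <= M * rnorm x.
Proof.
by apply/(linear_rbounded_continuous f); case: f => f /= /asboolP[].
Qed.

Lemma dual_submod_closed : submod_closed dual_pred.
Proof.
split=> [|k f g].
  apply: dual_predP => [c x y|]; first by rewrite /= scaler0 addr0.
  by exists 0 => x; rewrite mul0r rnorm0.
move=> fP gP; have [M fM] := dual_bounded (Dual fP).
have [N gN] := dual_bounded (Dual gP).
apply: dual_predP => [c x y|].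
  have fl : linear f := dual_linear (Dual fP).
  have gl : linear g := dual_linear (Dual gP).
  rewrite !fctE fl gl.
  by rewrite !scalerDr !scalerA (mulrC k) addrACA.
exists (rnorm (k : R[i]^o) * M + N) => x; rewrite (le_trans (rnormD _ _))//.
by rewrite rnormZ mulrDl lerD// -mulrA ler_wpM2l// rnorm_ge0.
Qed.

HB.instance Definition _ :=
  GRing.isSubmodClosed.Build R[i] (V -> R[i]^o) dual_pred dual_submod_closed.
HB.instance Definition _ := [SubChoice_isSubLmodule of dual by <:].

Definition dual_norm (f : dual) : R :=
  sup [set rnorm (f x) | x in [set x | rnorm x <= 1]].

Lemma dual_norm_has_sup (f : dual) :
  has_sup [set rnorm (f x) | x in [set x | rnorm x <= 1]].
Proof.
split; first by exists (rnorm (f 0)), 0 => //=; rewrite rnorm0.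
have [M fM] := dual_bounded f; exists `|M| => _ [x /= x1 <-].
rewrite (le_trans (fM x))// (@le_trans _ _ (`|M| * rnorm x))//.
  by rewrite ler_wpM2r ?rnorm_ge0// ler_norm.
by rewrite ler_piMr.
Qed.

Lemma dual_normP (f : dual) x : rnorm (f x) <= dual_norm f * rnorm x.
Proof.
have [->|x0] := eqVneq x 0; first by rewrite linear0 !rnorm0 mulr0.
have rx0 : 0 < rnorm x.
  by rewrite lt_neqAle rnorm_ge0 andbT eq_sym; apply: contra_neq x0 => /rnorm0_eq0.
have rC : rnorm (((rnorm x)^-1)%:C%C : R[i]^o) = (rnorm x)^-1.
  by rewrite /rnorm ger0_norm// ler0c invr_ge0 rnorm_ge0.
rewrite -ler_pdivrMr// mulrC -rC -rnormZ -linearZ/=.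
apply: ub_le_sup; first by case: (dual_norm_has_sup f).
exists (((rnorm x)^-1)%:C%C *: x) => //=.
by rewrite rnormZ rC mulVf ?gt_eqF.
Qed.

Lemma dual_norm_le (f : dual) (M : R) :
  (forall x, rnorm x <= 1 -> rnorm (f x) <= M) -> dual_norm f <= M.
Proof.
move=> fM; apply: ge_sup; first by case: (dual_norm_has_sup f).
by move=> _ [x /= x1 <-]; exact: fM.
Qed.

Lemma dual_norm_ge0 (f : dual) : 0 <= dual_norm f.
Proof.
rewrite (@le_trans _ _ (rnorm (f 0)))// ?rnorm_ge0//.
apply: ub_le_sup; first by case: (dual_norm_has_sup f).
by exists 0 => //=; rewrite rnorm0.
Qed.

Lemma dual_normD (f g : dual) :
  ((dual_norm (f + g))%:C <= (dual_norm f)%:C + (dual_norm g)%:C)%C.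
Proof.
rewrite -rmorphD/= lecR; apply: dual_norm_le => x x1.
rewrite (le_trans (rnormD _ _))// lerD//.
  by rewrite (le_trans (dual_normP _ _))// ler_piMr ?dual_norm_ge0.
by rewrite (le_trans (dual_normP _ _))// ler_piMr ?dual_norm_ge0.
Qed.

Lemma dual_normZ (k : R[i]) (f : dual) :
  ((dual_norm (k *: f))%:C = `|k| * (dual_norm f)%:C)%C.
Proof.
have normZ_le c (g : dual) :
    dual_norm (c *: g) <= rnorm (c : R[i]^o) * dual_norm g.
  apply: dual_norm_le => x x1.
  rewrite [X in rnorm X](_ : _ = c *: g x)// rnormZ ler_wpM2l ?rnorm_ge0//.
  by rewrite (le_trans (dual_normP _ _))// ler_piMr ?dual_norm_ge0.
rewrite -(rnormE (k : R[i]^o)) -rmorphM/=; congr (_%:C)%C.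
apply/eqP; rewrite eq_le normZ_le/=.
have [->|k0] := eqVneq k 0; first by rewrite rnorm0 mul0r dual_norm_ge0.
have rk0 : 0 < rnorm (k : R[i]^o).
  by rewrite -ltcR rnormE normr_gt0.
rewrite -ler_pdivlMl//.
have := normZ_le k^-1 (k *: f); rewrite scalerA mulVf// scale1r.
by rewrite [rnorm (k^-1 : R[i]^o)](_ : _ = (rnorm (k : R[i]^o))^-1)//;
   apply: complexI; rewrite fmorphV/= !rnormE normfV.
Qed.

Lemma dual_norm0_eq0 (f : dual) : ((dual_norm f)%:C = 0)%C -> f = 0.
Proof.
move=> /complexI f0; apply/val_inj/funext => x; apply: rnorm0_eq0.
by apply/le_anti; rewrite rnorm_ge0 andbT (le_trans (dual_normP _ _))// f0 mul0r.
Qed.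

HB.instance Definition _ := Lmodule_isNormed.Build R[i] dual
  dual_normD dual_normZ dual_norm0_eq0.

Lemma rnorm_dualE (f : dual) :
  rnorm f = sup [set rnorm (f x) | x in [set x | rnorm x <= 1]].
Proof. by []. Qed.

Lemma rnorm_dualP (f : dual) x : rnorm (f x) <= rnorm f * rnorm x.
Proof. exact: dual_normP. Qed.

Lemma rnorm_dual_le (f : dual) (M : R) :
  (forall x, rnorm x <= 1 -> rnorm (f x) <= M) -> rnorm f <= M.
Proof. exact: dual_norm_le. Qed.

End Dual.

Notation bidual V := (dual (dual V)).

(* The product of the second dual B** of a C*-algebra B, extending the one of B:
   the Arens product, (F G)(f) = F (G . f) where (G . f)(x) = G (f . x) and
   (f . x)(y) = f (x y). *)
Section SecondDual.
Context {R : realType} (B : cstarAlgType R).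
Implicit Types (f : dual B) (x y : B) (F G : bidual B).

Lemma rnorm_cmul x y : rnorm (x ** y) <= rnorm x * rnorm y.
Proof. by rewrite -lecR rmorphM/= !rnormE cnormM. Qed.

Lemma dual_mul_bound f x y :
  rnorm (f (x ** y)) <= rnorm f * rnorm x * rnorm y.
Proof.
rewrite (le_trans (rnorm_dualP _ _))// -mulrA ler_wpM2l ?rnorm_ge0//.
exact: rnorm_cmul.
Qed.

Fact dual_mul_subproof f x : (fun y => f (x ** y)) \in @dual_pred R B.
Proof.
apply: dual_predP => [k y z|]; first by rewrite cmulDr -cscaleAr linearP.
by exists (rnorm f * rnorm x) => y; exact: dual_mul_bound.
Qed.
Definition dual_mul f x : dual B := Dual (dual_mul_subproof f x).

Fact bidual_act_subproof G f : (fun x => G (dual_mul f x)) \in @dual_pred R B.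
Proof.
apply: dual_predP => [k x y|].
  rewrite -linearP; congr (G _); apply/val_inj/funext => z /=.
  by rewrite cmulDl -cscaleAl linearP.
exists (rnorm G * rnorm f) => x; rewrite (le_trans (rnorm_dualP _ _))//.
rewrite -mulrA ler_wpM2l ?rnorm_ge0//; apply: rnorm_dual_le => y y1.
by rewrite (le_trans (dual_mul_bound _ _ _))// ler_piMr// mulr_ge0 ?rnorm_ge0.
Qed.
Definition bidual_act G f : dual B := Dual (bidual_act_subproof G f).

Fact arens_subproof F G : (fun f => F (bidual_act G f)) \in @dual_pred R (dual B).
Proof.
apply: dual_predP => [k f g|].
  rewrite -linearP; congr (F _); apply/val_inj/funext => x /=.
  by rewrite -[RHS]linearP; congr (G _); apply/val_inj/funext.
exists (rnorm F * rnorm G) => f; rewrite (le_trans (rnorm_dualP _ _))//.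
rewrite -mulrA ler_wpM2l ?rnorm_ge0//; apply: rnorm_dual_le => x x1.
rewrite (le_trans (rnorm_dualP G _))// ler_wpM2l ?rnorm_ge0//.
apply: rnorm_dual_le => y y1; rewrite (le_trans (dual_mul_bound _ _ _))//.
rewrite (@le_trans _ _ (rnorm f * rnorm x))// ?ler_piMr ?rnorm_ge0//.
by rewrite mulr_ge0 ?rnorm_ge0.
Qed.
Definition arens F G : bidual B := Dual (arens_subproof F G).

Fact to_bidual_subproof x : (fun f => f x) \in @dual_pred R (dual B).
Proof.
apply: dual_predP => // ; exists (rnorm x) => f.
by rewrite mulrC; exact: rnorm_dualP.
Qed.
Definition to_bidual x : bidual B := Dual (to_bidual_subproof x).

Definition weak_star_limit (d : Order.disp_t) (L : preorderType d)
    (x : L -> bidual B) (F : bidual B) :=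
  forall f, x l f @[l --> net_filter L] --> F f.

Lemma arens_to_bidual x y :
  arens (to_bidual x) (to_bidual y) = to_bidual (x ** y).
Proof. by apply/val_inj/funext. Qed.

End SecondDual.

(* Main.v *)
(* Evaluated at a positive h in A, 2-positivity makes the form
     (c, w) |-> c^* phi(y^* h y) c - c^* phi(y^* h) w - w^* phi(h y) c + w^* phi(h) w
   nonnegative on pairs (c, w) from the unitization of B, for every y in A.
   Put H = phi(h), p = phi(a), q = phi(a^2). If p^2 = q H, then H commutes with
   p^2, hence with p, and the form vanishes at y = a, c = H, w = p; the value
   at y = k a + b, c = H, w = k p is then real-affine in the scalar k, so that its
   linear coefficient, which is (H phi(ab) - p phi(b)) H for h = 1, has to
   vanish. The last factor H is removed by using that phi(b) is dominated by H.
   All steps are estimates, with constants that do not depend on phi.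

   Positivity in a C*-algebra is developed from the square root of 1 - x for
   |x| <= 1: s = s^* and |s| <= 1 give r = sqrt(1 - s^2) with r + i s unitary,
   and this replaces functional calculus. The weak* limit of phi(h_l) exists
   because a bounded functional cannot oscillate along a bounded increasing
   net, and the Arens product of that limit with an element of B is itself a
   limit, so the estimate in B is enough. *)
Require Import Defs.
From HB Require Import structures.
From mathcomp Require Import all_boot all_order all_algebra.
From mathcomp Require Import all_classical all_reals all_analysis.
From mathcomp Require Import complex.
From mathcomp Require Import ring lra.

Set Implicit Arguments.
Unset Strict Implicit.
Unset Printing Implicit Defensive.

Import Order.TTheory GRing.Theory Num.Theory.
Import numFieldNormedType.Exports.

Local Open Scope classical_set_scope.
Local Open Scope ring_scope.

(** * Noncommutative ring identities *)

Section NoncommutativeRing.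
Variable K : nzRingType.

Inductive ncterm :=
| NCvar of nat
| NCzero
| NCone
| NCadd of ncterm & ncterm
| NCopp of ncterm
| NCmul of ncterm & ncterm.

Fixpoint nceval (e : seq K) t : K :=
  match t with
  | NCvar n => e`_n
  | NCzero => 0
  | NCone => 1
  | NCadd t u => nceval e t + nceval e u
  | NCopp t => - nceval e t
  | NCmul t u => nceval e t * nceval e u
  end.

(* A term is normalized into its positive and negative monomials, a monomial
   being the list of its factors. *)
Fixpoint ncnorm t : seq (seq nat) * seq (seq nat) :=
  match t with
  | NCvar n => ([:: [:: n]], [::])
  | NCzero => ([::], [::])
  | NCone => ([:: [::]], [::])
  | NCadd t u =>
      ((ncnorm t).1 ++ (ncnorm u).1, (ncnorm t).2 ++ (ncnorm u).2)
  | NCopp t => ((ncnorm t).2, (ncnorm t).1)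
  | NCmul t u =>
      let p := ncnorm t in let q := ncnorm u in
      ([seq x ++ y | x <- p.1, y <- q.1] ++ [seq x ++ y | x <- p.2, y <- q.2],
       [seq x ++ y | x <- p.1, y <- q.2] ++ [seq x ++ y | x <- p.2, y <- q.1])
  end.

Definition ncsum (e : seq K) (s : seq (seq nat)) : K :=
  \sum_(x <- s) \prod_(n <- x) e`_n.

Lemma ncsum_cat e s1 s2 : ncsum e (s1 ++ s2) = ncsum e s1 + ncsum e s2.
Proof. exact: big_cat. Qed.

Lemma ncsum_mul e s1 s2 :
  ncsum e [seq x ++ y | x <- s1, y <- s2] = ncsum e s1 * ncsum e s2.
Proof.
rewrite /ncsum big_allpairs_dep/= mulr_suml; apply: eq_bigr => x _.
by rewrite mulr_sumr; apply: eq_bigr => y _; rewrite big_cat.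
Qed.

Lemma nceval_norm e t : nceval e t = ncsum e (ncnorm t).1 - ncsum e (ncnorm t).2.
Proof.
elim: t => [n|||t IHt u IHu|t IHt|t IHt u IHu] /=.
- by rewrite /ncsum !big_seq1 big_nil subr0.
- by rewrite /ncsum !big_nil subr0.
- by rewrite /ncsum big_seq1 !big_nil subr0.
- by rewrite !ncsum_cat IHt IHu opprD addrACA.
- by rewrite IHt opprB.
- rewrite !ncsum_cat !ncsum_mul IHt IHu mulrBl !mulrBr opprB opprD !addrA.
  by congr (_ - _); rewrite addrAC.
Qed.

(** Moving the negative monomials to the other side reduces the identity to an equality of
    multisets, so opposite monomials need not be cancelled beforehand. *)
Lemma ncring_eq e t u :
  perm_eq ((ncnorm t).1 ++ (ncnorm u).2) ((ncnorm u).1 ++ (ncnorm t).2) ->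
  nceval e t = nceval e u.
Proof.
move=> tu; rewrite !nceval_norm; apply/eqP.
by rewrite subr_eq addrAC eq_sym subr_eq -!ncsum_cat eq_sym /ncsum (perm_big _ tu).
Qed.

End NoncommutativeRing.

(* Up to unification: an element may occur through different structures. *)
Ltac nc_index x e :=
  match e with
  | ?y :: _ => let _ := match x with _ => unify x y end in constr:(O)
  | _ :: ?e' => let n := nc_index x e' in constr:(S n)
  end.

Ltac nc_insert x e :=
  match e with
  | _ => let n := nc_index x e in e
  | _ => constr:(x :: e)
  end.

Ltac nc_atoms e t :=
  lazymatch t with
  | @GRing.add _ ?u ?v => let e := nc_atoms e u in nc_atoms e v
  | @GRing.mul _ ?u ?v => let e := nc_atoms e u in nc_atoms e v
  | @GRing.opp _ ?u => nc_atoms e u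
  | @GRing.zero _ => e
  | @GRing.one _ => e
  | _ => nc_insert t e
  end.

Ltac nc_reify e t :=
  lazymatch t with
  | @GRing.add _ ?u ?v =>
      let u := nc_reify e u in let v := nc_reify e v in constr:(NCadd u v)
  | @GRing.mul _ ?u ?v =>
      let u := nc_reify e u in let v := nc_reify e v in constr:(NCmul u v)
  | @GRing.opp _ ?u => let u := nc_reify e u in constr:(NCopp u)
  | @GRing.zero _ => constr:(NCzero)
  | @GRing.one _ => constr:(NCone)
  | _ => let n := nc_index t e in constr:(NCvar n)
  end.

(* Decides identities in a ring that need not be commutative. *)
Ltac ncring :=
  lazymatch goal with
  | |- @eq ?K ?t ?u =>
    let e := nc_atoms (@nil K) t in let e := nc_atoms e u in
    let t' := nc_reify e t in let u' := nc_reify e u in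
    apply: (@ncring_eq _ e t' u'); vm_compute; reflexivity
  end.

(** * The unitization and its norm *)

Section RealNormTheory.
Context {R : realType}.
Implicit Types V : normedModType R[i].

Lemma rnormN V (x : V) : rnorm (- x) = rnorm x.
Proof. by apply: complexI; rewrite !rnormE normrN. Qed.

Lemma rnormB V (x y : V) : rnorm (x - y) <= rnorm x + rnorm y.
Proof. by rewrite -(rnormN y) rnormD. Qed.

Lemma rnorm_distrC V (x y : V) : rnorm (x - y) = rnorm (y - x).
Proof. by rewrite -rnormN opprB. Qed.

Lemma rnorm_real (c : R) : rnorm (c%:C%C : R[i]^o) = `|c|.
Proof. by apply: complexI; rewrite rnormE normc_def /= expr0n addr0 sqrtr_sqr. Qed.

Lemma rnorm_i : rnorm ('i%C : R[i]^o) = 1.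
Proof.
by apply: complexI; rewrite rnormE normc_def /= expr0n expr1n add0r sqrtr1.
Qed.

Lemma rnormZr V (c : R) (x : V) : rnorm (c%:C%C *: x) = `|c| * rnorm x.
Proof. by rewrite rnormZ rnorm_real. Qed.

Lemma rnorm_gt0 V (x : V) : x != 0 -> 0 < rnorm x.
Proof.
by move=> x0; rewrite lt_neqAle rnorm_ge0 andbT eq_sym;
   apply: contra_neq x0 => /rnorm0_eq0.
Qed.

Lemma rnormM (k l : R[i]) :
  rnorm (k * l : R[i]^o) = rnorm (k : R[i]^o) * rnorm (l : R[i]^o).
Proof. exact: (rnormZ k (l : R[i]^o)). Qed.

Lemma rnorm_conjc (k : R[i]) : rnorm ((k^*)%C : R[i]^o) = rnorm (k : R[i]^o).
Proof. by apply: complexI; rewrite !rnormE; case: k => x y; rewrite !normc_def/= sqrrN. Qed.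

Lemma rnormZi V (x : V) : rnorm ('i%C *: x) = rnorm x.
Proof. by rewrite rnormZ rnorm_i mul1r. Qed.

End RealNormTheory.

Section CStarTheory.
Context {R : realType} {A : cstarAlgType R}.
Implicit Types x y z : A.

Lemma cmul0l x : 0 ** x = 0.
Proof. by apply: (addIr (0 ** x)); rewrite -cmulDl !add0r. Qed.

Lemma cmul0r x : x ** 0 = 0.
Proof. by apply: (addIr (x ** 0)); rewrite -cmulDr !add0r. Qed.

Lemma cmulNr x y : x ** (- y) = - (x ** y).
Proof. by apply: (addIr (x ** y)); rewrite -cmulDr !addNr cmul0r. Qed.

Lemma cstar0 : cstar (0 : A) = 0.
Proof. by apply: (addIr (cstar 0)); rewrite -cstarD !add0r. Qed.

Lemma cstarN x : cstar (- x) = - cstar x.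
Proof. by apply: (addIr (cstar x)); rewrite -cstarD !addNr cstar0. Qed.

Lemma rnorm_cstar_mul x : rnorm (cstar x ** x) = rnorm x ^+ 2.
Proof. by apply: complexI; rewrite rmorphXn /= !rnormE cnorm_star. Qed.

Lemma rnorm_cstar_le x : rnorm x <= rnorm (cstar x).
Proof.
have [->|x0] := eqVneq x 0; first by rewrite rnorm0 rnorm_ge0.
have r0 := rnorm_gt0 x0.
by rewrite -(ler_pM2r r0) -expr2 -rnorm_cstar_mul rnorm_cmul.
Qed.

Lemma rnorm_cstar x : rnorm (cstar x) = rnorm x.
Proof.
by apply/le_anti; rewrite rnorm_cstar_le -{2}[x]cstarK rnorm_cstar_le.
Qed.

Lemma positive_elt_sa x : positive_elt x -> cstar x = x.
Proof. by move=> [y ->]; rewrite cstarM cstarK. Qed.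

Lemma cmul_le1 x y : rnorm x <= 1 -> rnorm y <= 1 -> rnorm (x ** y) <= 1.
Proof.
move=> x1 y1; rewrite (le_trans (rnorm_cmul _ _))// -[1](mulr1 1).
by rewrite ler_pM ?rnorm_ge0.
Qed.

End CStarTheory.

(** A unit is adjoined whether or not [A] has one; the result is a ring, to which the generic ring
    lemmas and [ncring] apply. *)
Definition unitization (R : realType) (A : cstarAlgType R) : Type :=
  (R[i]^o * A)%type.

Section Unitization.
Context {R : realType} {A : cstarAlgType R}.
Local Notation U := (unitization A).

HB.instance Definition _ := GRing.Lmodule.copy U (R[i]^o * A)%type.

Definition umul (x y : U) : U :=
  (x.1 * y.1, x.1 *: y.2 + y.1 *: x.2 + x.2 ** y.2).

Fact umulA : associative umul.
Proof.
move=> [k a] [l b] [m c]; rewrite /umul/=; congr (_, _); first by rewrite mulrA.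
rewrite !scalerDr !cmulDl !cmulDr !scalerA -!cscaleAl -!cscaleAr cmulA.
rewrite -!addrA (mulrC m k) (mulrC m l); congr (_ + (_ + _)).
by rewrite addrCA; congr (_ + _); rewrite (addrCA (l *: _)) addrCA.
Qed.

Fact umul1l : left_id ((1, 0) : U) umul.
Proof.
by move=> [k a]; rewrite /umul/= mul1r scale1r scaler0 addr0 cmul0l addr0.
Qed.

Fact umul1r : right_id ((1, 0) : U) umul.
Proof.
by move=> [k a]; rewrite /umul/= mulr1 scale1r scaler0 add0r cmul0r addr0.
Qed.

Fact umulDl : left_distributive umul +%R.
Proof.
move=> [k a] [l b] [m c]; congr (_, _); rewrite /umul/= ?mulrDl//.
by rewrite scalerDl scalerDr cmulDl (addrACA (k *: c)) (addrACA (k *: c + _)).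
Qed.

Fact umulDr : right_distributive umul +%R.
Proof.
move=> [k a] [l b] [m c]; congr (_, _); rewrite /umul/= ?mulrDr//.
by rewrite scalerDl scalerDr cmulDr (addrACA (k *: b)) (addrACA (k *: b + _)).
Qed.

Fact uone_neq0 : ((1, 0) : U) != 0.
Proof. by apply/eqP => -[/eqP]; rewrite oner_eq0. Qed.

HB.instance Definition _ := GRing.Zmodule_isNzRing.Build U
  umulA umul1l umul1r umulDl umulDr uone_neq0.

Fact uscaleAl (k : R[i]) (x y : U) : k *: (x * y) = (k *: x) * y.
Proof.
congr (_, _); rewrite /= -?scalerAl//.
by rewrite !scalerDr !scalerA cscaleAl (mulrC k y.1).
Qed.

HB.instance Definition _ := GRing.Lmodule_isLalgebra.Build R[i] U uscaleAl.

Fact uscaleAr (k : R[i]) (x y : U) : k *: (x * y) = x * (k *: y).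
Proof.
congr (_, _); first by rewrite /= /GRing.scale/= mulrCA.
by rewrite /= !scalerDr !scalerA cscaleAr (mulrC k x.1).
Qed.

HB.instance Definition _ := GRing.Lalgebra_isAlgebra.Build R[i] U uscaleAr.

Definition ustar (x : U) : U := ((x.1^*)%C, cstar x.2).

Definition emb (a : A) : U := (0, a).

Definition act (x : U) (b : A) : A := x.1 *: b + x.2 ** b.

(* [bnd x M] says that the C*-norm of [x] is at most [M]; bounding the scalar
   part as well makes this a norm on [U] even when [A] already has a unit. *)
Definition bnd (x : U) (M : R) :=
  rnorm (x.1 : R[i]^o) <= M /\ forall b, rnorm (act x b) <= M * rnorm b.

Implicit Types x y z : U.
Implicit Types a b : A.

Lemma ustarK : involutive ustar.
Proof. by move=> [k a]; rewrite /ustar/= conjcK cstarK. Qed.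

Lemma ustarD : {morph ustar : x y / x + y}.
Proof. by move=> [k a] [l b]; rewrite /ustar/= rmorphD/= cstarD. Qed.

Lemma ustarN : {morph ustar : x / - x}.
Proof. by move=> [k a]; rewrite /ustar/= rmorphN/= cstarN. Qed.

Lemma ustarB : {morph ustar : x y / x - y}.
Proof. by move=> x y; rewrite ustarD ustarN. Qed.

Lemma ustarZ (k : R[i]) x : ustar (k *: x) = (k^*)%C *: ustar x.
Proof. by case: x => l a; rewrite /ustar/= rmorphM/= cstarZ. Qed.

Lemma ustarZr (c : R) x : ustar (c%:C%C *: x) = c%:C%C *: ustar x.
Proof. by rewrite ustarZ; congr (_ *: _); apply/eqP; rewrite eq_complex/= oppr0 !eqxx. Qed.

Lemma ustar0 : ustar 0 = 0.
Proof. by apply: (addIr (ustar 0)); rewrite -ustarD !add0r. Qed.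

Lemma ustar1 : ustar 1 = 1.
Proof. by congr (_, _); [exact: conjc1|exact: cstar0]. Qed.

Lemma ustarM x y : ustar (x * y) = ustar y * ustar x.
Proof.
case: x y => [k a] [l b]; congr (_, _); rewrite /= ?rmorphM/= 1?mulrC//.
by rewrite !cstarD !cstarZ cstarM (addrC ((k^*)%C *: _)).
Qed.

Lemma embD : {morph emb : a b / a + b}.
Proof. by move=> a b; rewrite /emb; congr (_, _); rewrite /= addr0. Qed.

Lemma embN : {morph emb : a / - a}.
Proof. by move=> a; rewrite /emb; congr (_, _); rewrite /= oppr0. Qed.

Lemma embB : {morph emb : a b / a - b}.
Proof. by move=> a b; rewrite embD embN. Qed.

Lemma embM : {morph emb : a b / a ** b >-> a * b}.
Proof.
by move=> a b; rewrite /emb; congr (_, _); rewrite /= ?mulr0// !scale0r !add0r.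
Qed.

Lemma embZ (k : R[i]) a : emb (k *: a) = k *: emb a.
Proof. by rewrite /emb; congr (_, _); rewrite /= scaler0. Qed.

Lemma emb_star a : emb (cstar a) = ustar (emb a).
Proof. by congr (_, _); rewrite conjc0. Qed.

Lemma actDl x y b : act (x + y) b = act x b + act y b.
Proof. by rewrite /act scalerDl cmulDl addrACA. Qed.

Lemma actM x y b : act (x * y) b = act x (act y b).
Proof.
rewrite /act/= !scalerDr !cmulDl !cmulDr -!cscaleAl -!cscaleAr cmulA.
by rewrite scalerA !addrA; congr (_ + _); rewrite addrAC.
Qed.

End Unitization.

(** * Norm bounds in the unitization *)

Section Bounds.
Context {R : realType} {A : cstarAlgType R}.
Local Notation U := (unitization A).
Implicit Types (x y z : U) (a b c : A) (M N : R).

Lemma act1 b : act (1 : U) b = b.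
Proof. by rewrite /act/= scale1r cmul0l addr0. Qed.

Lemma actZ (k : R[i]) x b : act (k *: x) b = k *: act x b.
Proof. by rewrite /act/= scalerDr scalerA cscaleAl. Qed.

Lemma act_emb a b : act (emb a) b = a ** b.
Proof. by rewrite /act/= scale0r add0r. Qed.

Lemma act0 b : act (0 : U) b = 0.
Proof. by rewrite /act/= scale0r cmul0l addr0. Qed.

Lemma actN x b : act (- x) b = - act x b.
Proof. by rewrite -scaleN1r actZ scaleN1r. Qed.

(** [ustar x] acts as the adjoint of [x] for the [A]-valued inner product [b, c |-> b^* c]. The
    C*-norm estimates below rest on this. *)
Lemma act_ustar x b c : cstar (act x b) ** c = cstar b ** act (ustar x) c.
Proof.
rewrite /act cstarD cstarZ cstarM cmulDl cmulDr/= -cscaleAl -cscaleAr.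
by rewrite cmulA.
Qed.

Lemma bnd_le x M N : M <= N -> bnd x M -> bnd x N.
Proof.
move=> MN [sM xM]; split=> [|b]; first exact: le_trans MN.
by rewrite (le_trans (xM b))// ler_wpM2r ?rnorm_ge0.
Qed.

Lemma bndD x y M N : bnd x M -> bnd y N -> bnd (x + y) (M + N).
Proof.
move=> [sM xM] [sN yN]; split=> [|b].
  by rewrite (le_trans (rnormD _ _))// lerD.
rewrite actDl (le_trans (rnormD _ _))// mulrDl.
by rewrite lerD ?xM ?yN.
Qed.

Lemma bndN x M : bnd x M -> bnd (- x) M.
Proof. by move=> [sM xM]; split=> [|b]; rewrite ?actN rnormN. Qed.

Lemma bndB x y M N : bnd x M -> bnd y N -> bnd (x - y) (M + N).
Proof. by move=> xM yN; apply: bndD => //; exact: bndN. Qed.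

Lemma bnd_distrC x y M : bnd (x - y) M -> bnd (y - x) M.
Proof. by move=> /bndN; rewrite opprB. Qed.

Lemma bndM x y M N : 0 <= M -> bnd x M -> bnd y N -> bnd (x * y) (M * N).
Proof.
move=> M0 [sM xM] [sN yN]; split=> [|b].
  by rewrite rnormM ler_pM ?rnorm_ge0.
by rewrite actM (le_trans (xM _))// -mulrA ler_wpM2l// yN.
Qed.

Lemma bnd_contrM x y M : 0 <= M -> bnd x 1 -> bnd y M -> bnd (x * y) M.
Proof. by move=> M0 x1 yM; rewrite -[M]mul1r; exact: bndM. Qed.

Lemma bndM_contr x y M : 0 <= M -> bnd x M -> bnd y 1 -> bnd (x * y) M.
Proof. by move=> M0 x1 yM; rewrite -[M]mulr1; exact: bndM. Qed.

Lemma bndZr x (c : R) M : bnd x M -> bnd (c%:C%C *: x) (`|c| * M).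
Proof.
move=> [sM xM]; split=> [|b]; first by rewrite rnormZr ler_wpM2l.
by rewrite actZ rnormZr -mulrA ler_wpM2l// xM.
Qed.

Lemma bndZi x M : bnd x M -> bnd ('i%C *: x) M.
Proof. by move=> [sM xM]; split=> [|b]; rewrite ?actZ rnormZi. Qed.

Lemma bnd0 : bnd (0 : U) 0.
Proof. by split=> [|b]; rewrite ?act0 rnorm0 ?mul0r. Qed.

Lemma bnd1 : bnd (1 : U) 1.
Proof. by split=> [|b]; rewrite ?act1 ?mul1r// rnorm_real normr1. Qed.

Lemma bnd_real (c : R) : bnd (c%:C%C *: 1 : U) `|c|.
Proof. by rewrite -[`|c|]mulr1; apply: bndZr; exact: bnd1. Qed.

Lemma bnd_exists x : exists2 M, 0 <= M & bnd x M.
Proof.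
exists (rnorm (x.1 : R[i]^o) + rnorm x.2); first by rewrite addr_ge0 ?rnorm_ge0.
split=> [|b]; first by rewrite lerDl rnorm_ge0.
rewrite (le_trans (rnormD _ _))// rnormZ mulrDl lerD//.
exact: rnorm_cmul.
Qed.

Lemma sqr_le_rnorm a M : 0 <= M -> rnorm a ^+ 2 <= M * rnorm a -> rnorm a <= M.
Proof.
move=> M0; have := rnorm_ge0 a; rewrite le_eqVlt => /predU1P[<-//|a0].
by rewrite expr2 ler_pM2r.
Qed.

(** With [c = x^* b], the adjoint relation gives [|c|^2 = |b^* x c| <= |b| M |c|]. *)
Lemma bnd_ustar x M : 0 <= M -> bnd x M -> bnd (ustar x) M.
Proof.
move=> M0 [sM xM]; split=> [|b]; first by rewrite rnorm_conjc.
apply: sqr_le_rnorm; first by rewrite mulr_ge0 ?rnorm_ge0.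
rewrite -rnorm_cstar_mul act_ustar ustarK (le_trans (rnorm_cmul _ _))//.
by rewrite rnorm_cstar (mulrC M) -mulrA ler_wpM2l ?rnorm_ge0.
Qed.

(** The lower bound comes from the action on [a^*], since [|a a^*| = |a|^2]. *)
Lemma bnd_emb a M : 0 <= M -> bnd (emb a) M <-> rnorm a <= M.
Proof.
move=> M0; split=> [[_ aM]|aM]; last first.
  split=> [|b]; first by rewrite rnorm0.
  by rewrite act_emb (le_trans (rnorm_cmul _ _))// ler_wpM2r ?rnorm_ge0.
have := aM (cstar a); rewrite act_emb -{1}[a]cstarK rnorm_cstar_mul.
by rewrite !rnorm_cstar; exact: sqr_le_rnorm.
Qed.

(** The C*-identity of the unitization, from [|x b|^2 = |b^* x^* x b|]. *)
Lemma bnd_cstar x M : 0 <= M -> bnd (ustar x * x) (M ^+ 2) -> bnd x M.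
Proof.
move=> M0 [sM xM]; split=> [|b].
  by rewrite -ler_sqr ?nnegrE ?rnorm_ge0// expr2 -{1}rnorm_conjc -rnormM.
rewrite -ler_sqr ?nnegrE ?mulr_ge0 ?rnorm_ge0//.
rewrite -rnorm_cstar_mul act_ustar -actM (le_trans (rnorm_cmul _ _))//.
rewrite rnorm_cstar (_ : _ ^+ 2 = rnorm b * (M ^+ 2 * rnorm b)); last by ring.
by rewrite ler_wpM2l ?rnorm_ge0.
Qed.

Lemma bnd_sa_sqr x M : ustar x = x -> 0 <= M -> bnd (x * x) (M ^+ 2) -> bnd x M.
Proof. by move=> xs M0 xM; apply: bnd_cstar => //; rewrite xs. Qed.

Lemma bnd_lim x M : (forall e, 0 < e -> bnd x (M + e)) -> bnd x M.
Proof.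
move=> xM; split=> [|b]; apply/ler_addgt0Pr => e e0; first by case: (xM e e0).
have b1 : 0 < rnorm b + 1 by rewrite ltr_pwDr ?rnorm_ge0.
have [_ {}xM] := xM _ (divr_gt0 e0 b1).
rewrite (le_trans (xM b))// mulrDl lerD//.
by rewrite mulrAC ler_pdivrMr// ler_wpM2l ?ltW// ltrDl.
Qed.

Lemma bnd_half x M : bnd (x + x) (M + M) -> bnd x M.
Proof.
have h2 (V : normedModType R[i]) (v : V) (N : R) :
    rnorm (v + v) <= N + N -> rnorm v <= N.
  rewrite -mulr2n -scaler_nat.
  have -> : (2%:R : R[i]) = 2%:R%:C%C by rewrite rmorph_nat.
  by rewrite rnormZr normr_nat; lra.
move=> [sM xM]; split=> [|b]; apply: h2 => //.
by have := xM b; rewrite actDl mulrDl.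
Qed.

Lemma bnd_eq0 x : bnd x 0 -> x = 0.
Proof.
case: x => k a [k0 xM].
have {}k0 : k = 0 by apply: (@rnorm0_eq0 _ R[i]^o); apply/le_anti; rewrite k0 rnorm_ge0.
congr (_, _) => //; apply: rnorm0_eq0; apply/le_anti; rewrite rnorm_ge0 andbT.
apply/bnd_emb => //; split=> [|b]; first by rewrite rnorm0.
by have := xM b; rewrite k0.
Qed.

End Bounds.

(** * Square roots *)

Section Completeness.
Context {R : realType}.

Definition rcauchy (V : normedModType R[i]) (T : Type) (F : set_system T)
    (u : T -> V) :=
  forall e : R, 0 < e ->
    exists2 D, F D & forall s t, D s -> D t -> rnorm (u s - u t) <= e.

Definition rcvg (V : normedModType R[i]) (T : Type) (F : set_system T)
    (u : T -> V) (l : V) :=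
  forall e : R, 0 < e -> F [set t | rnorm (l - u t) <= e].

Lemma complex_gt0 (e : R[i]) : 0 < e -> exists2 r : R, 0 < r & e = r%:C%C.
Proof.
move=> e0; exists (complex.Re e); last by rewrite RRe_real// gtr0_real.
by rewrite -ltcR RRe_real// gtr0_real.
Qed.

Lemma rcvgP (V : normedModType R[i]) (T : Type) (F : set_system T)
    (FF : Filter F) (u : T -> V) (l : V) :
  rcvg F u l <-> u t @[t --> F] --> l.
Proof.
split=> [ul|/cvgrPdist_le ul e e0].
  apply/cvgrPdist_le => e /complex_gt0[r r0 ->].
  by apply: filterS (ul r r0) => t /=; rewrite -rnormE lecR.
have /ul : 0 < e%:C%C by rewrite ltcR.
by apply: filterS => t /=; rewrite -rnormE lecR.
Qed.

Lemma rcauchy_rcvg (V : completeNormedModType R[i]) (T : Type)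
    (F : set_system T) (FF : ProperFilter F) (u : T -> V) :
  rcauchy F u -> exists l, rcvg F u l.
Proof.
move=> uC; suff /cvg_ex[l ul] : cvg (u t @[t --> F]).
  by exists l; apply/rcvgP.
apply/cauchy_cvgP/cauchy_exP => e /complex_gt0[r r0 ->].
have r20 : 0 < r / 2 by rewrite divr_gt0.
have [D FD uD] := uC _ r20.
have [t0 Dt0] := filter_ex FD.
exists (u t0); suff : F [set t | ball (u t0) r%:C%C (u t)] by [].
apply: filterS FD => t Dt.
rewrite /= -ball_normE /= -rnormE ltcR (le_lt_trans (uD _ _ Dt0 Dt))//.
by rewrite ltr_pdivrMr// ltr_pMr// ltr1n.
Qed.

Lemma rnorm_ReIm (k : R[i]) : rnorm (k : R[i]^o) <= `|complex.Re k| + `|complex.Im k|.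
Proof.
case: k => x y /=; rewrite /rnorm normc_def/=.
rewrite -[leRHS]ger0_norm ?addr_ge0// -sqrtr_sqr ler_wsqrtr//.
by rewrite sqrrD !real_normK ?num_real// -addrA lerD2l lerDr mulrn_wge0// mulr_ge0.
Qed.

Lemma Re_le_rnorm (k : R[i]) : `|complex.Re k| <= rnorm (k : R[i]^o).
Proof.
case: k => x y /=; rewrite /rnorm normc_def/= -sqrtr_sqr ler_wsqrtr//.
by rewrite lerDl sqr_ge0.
Qed.

Lemma Im_le_rnorm (k : R[i]) : `|complex.Im k| <= rnorm (k : R[i]^o).
Proof.
case: k => x y /=; rewrite /rnorm normc_def/= -sqrtr_sqr ler_wsqrtr//.
by rewrite lerDr sqr_ge0.
Qed.

Lemma real_cauchy_cvg (T : Type) (F : set_system T) (FF : ProperFilter F)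
    (u : T -> R) :
  (forall e : R, 0 < e -> exists2 D, F D & forall s t, D s -> D t -> `|u s - u t| <= e) ->
  exists l, forall e : R, 0 < e -> F [set t | `|l - u t| <= e].
Proof.
move=> uC; suff /cvg_ex[l ul] : cvg (u t @[t --> F]).
  by exists l => e e0; move/cvgrPdist_le: ul => /(_ e e0).
apply/cauchy_cvgP/cauchy_exP => r r0.
have r20 : 0 < r / 2 by rewrite divr_gt0.
have [D FD uD] := uC _ r20.
have [t0 Dt0] := filter_ex FD.
exists (u t0); suff : F [set t | ball (u t0) r (u t)] by [].
apply: filterS FD => t Dt.
rewrite /= -ball_normE /= (le_lt_trans (uD _ _ Dt0 Dt))//.
by rewrite ltr_pdivrMr// ltr_pMr// ltr1n.
Qed.

Lemma complex_cauchy_cvg (T : Type) (F : set_system T) (FF : ProperFilter F)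
    (u : T -> R[i]^o) :
  rcauchy F u -> exists l : R[i]^o, rcvg F u l.
Proof.
move=> uC.
have ReB (k l : R[i]) : complex.Re k - complex.Re l = complex.Re (k - l).
  by case: k; case: l.
have ImB (k l : R[i]) : complex.Im k - complex.Im l = complex.Im (k - l).
  by case: k; case: l.
have [|x ux] := @real_cauchy_cvg _ F FF (fun t => complex.Re (u t)).
  move=> e e0; have [D FD uD] := uC e e0; exists D => // s t Ds Dt.
  by rewrite ReB (le_trans (Re_le_rnorm _)) ?uD.
have [|y uy] := @real_cauchy_cvg _ F FF (fun t => complex.Im (u t)).
  move=> e e0; have [D FD uD] := uC e e0; exists D => // s t Ds Dt.
  by rewrite ImB (le_trans (Im_le_rnorm _)) ?uD.
exists (x +i* y)%C => e e0; have e2 : 0 < e / 2 by rewrite divr_gt0.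
apply: filterS2 (ux _ e2) (uy _ e2) => t /= xt yt.
rewrite (le_trans (rnorm_ReIm _))// [leRHS]splitr.
by rewrite lerD// -?ReB -?ImB.
Qed.

End Completeness.

Section SquareRoot.
Context {R : realType} {A : cstarAlgType R}.
Local Notation U := (unitization A).
Implicit Types (x y z : U).

(** Scalar parts and parts in [A] converge separately; the rate [e] survives because [bnd] is a
    closed condition. *)
Lemma bnd_complete (u : nat -> U) (e : nat -> R) :
  (forall n m, (n <= m)%N -> bnd (u m - u n) (e n)) ->
  (forall r, 0 < r -> exists n, e n <= r) ->
  exists l, forall n, bnd (l - u n) (e n).
Proof.
move=> ue e0.
have e_ge0 n : 0 <= e n by have [s _] := ue n n (leqnn _); exact: le_trans (rnorm_ge0 _) s.
(* The part in [A] of a difference is the difference minus its scalar part, hence the bound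
   [e n + e n]. *)
have small (V : normedModType R[i]) (v : nat -> V) :
    (forall n m, (n <= m)%N -> rnorm (v m - v n) <= e n + e n) ->
    rcauchy \oo v.
  move=> ve r r0; have r4 : 0 < r / 4%:R by rewrite divr_gt0.
  have [n en] := e0 _ r4; exists [set m | (n <= m)%N]; first exact: nbhs_infty_ge.
  move=> s t /= ns nt.
  rewrite -(subrK (v n) (v s)) -addrA (le_trans (rnormD _ _))//.
  rewrite (rnorm_distrC (v n)).
  by have := ve _ _ ns; have := ve _ _ nt; lra.
have [k uk] : exists k : R[i]^o, rcvg \oo (fun n => (u n).1 : R[i]^o) k.
  apply: complex_cauchy_cvg; apply: small => n m nm.
  by have [s _] := ue n m nm; rewrite (le_trans s)// lerDl.
have embE x : emb x.2 = x - x.1 *: 1.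
  case: x => l a; rewrite /emb; congr (_, _) => /=.
    by rewrite [X in _ - X]mulr1 subrr.
  by rewrite scaler0 subr0.
have [a ua] : exists a : A, rcvg \oo (fun n => (u n).2) a.
  apply: rcauchy_rcvg; apply: small => n m nm.
  have [s _] := ue n m nm.
  apply/bnd_emb; first by rewrite addr_ge0.
  have -> : emb ((u m).2 - (u n).2) = (u m - u n) - (u m - u n).1 *: 1.
    by rewrite -embE.
  apply: bndB; first exact: ue.
  split=> [|b]; first by rewrite [X in rnorm X]mulr1.
  by rewrite actZ act1 rnormZ ler_wpM2r ?rnorm_ge0.
exists (k, a) => n; apply: bnd_lim => r r0.
have r2 : 0 < r / 2 by rewrite divr_gt0.
have [N _ uN] := filterI (uk _ r2) (ua _ r2).
have [/= kN aN] := uN (maxn N n) (leq_maxl _ _).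
rewrite -(subrK (u (maxn N n)) (k, a)) -addrA addrC; apply: bndD.
  exact: ue (leq_maxr _ _).
rewrite [r]splitr (_ : (k, a) - _ = (k - (u (maxn N n)).1) *: 1
    + emb (a - (u (maxn N n)).2)).
  apply: bndD; last by apply/bnd_emb; rewrite ?(ltW r2).
  split=> [|b]; first by rewrite [X in rnorm X]mulr1.
  by rewrite actZ act1 rnormZ ler_wpM2r ?rnorm_ge0.
rewrite /emb; congr (_, _) => /=; first by rewrite [_ *: _]mulr1 addr0.
by rewrite scaler0 add0r.
Qed.

(* The recursion y := (x + y^2)/2 has the fixed point 1 - sqrt(1 - x); it is
   majorized by the same recursion for x = 1, whose limit is 1. *)
Fixpoint sqrt_seq x n : U :=
  if n is n'.+1 then (2^-1)%:C%C *: (x + sqrt_seq x n' * sqrt_seq x n') else 0.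

Fixpoint sqrt_maj n : R :=
  if n is n'.+1 then (1 + sqrt_maj n' ^+ 2) / 2 else 0.

Lemma sqrt_maj_itv n : 0 <= sqrt_maj n <= 1.
Proof. by elim: n => [|n /andP[r0 r1]] /=; [rewrite lexx ler01|nra]. Qed.

Lemma sqrt_maj_le n : sqrt_maj n <= sqrt_maj n.+1.
Proof. by have /andP[] := sqrt_maj_itv n; rewrite /=; nra. Qed.

(** For [t = 1 - sqrt_maj n] the recursion reads [t |-> t - t^2 / 2], which increases on [0, 1] and
    sends [2 / N] below [2 / (N + 1)]. The explicit rate serves again in [bnd_commutator]. *)
Lemma sqrt_maj_ge n : 1 - sqrt_maj n <= 2 / n.+2%:R.
Proof.
elim: n => [|n IHn] /=; first by rewrite subr0 divff.
have /andP[r0 r1] := sqrt_maj_itv n.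
have n0 : (0 : R) < n.+2%:R by rewrite ltr0n.
have n1 : (0 : R) < n.+3%:R by rewrite ltr0n.
have nE : n.+3%:R = n.+2%:R + 1 :> R by rewrite -natr1.
have n2 : (2 : R) <= n.+2%:R by rewrite ler_nat.
move: IHn; rewrite ler_pdivlMr// => IHn; rewrite ler_pdivlMr// nE.
move: n2 {n0 n1 nE} IHn; set N := (n.+2%:R : R); set r := sqrt_maj n in r0 r1 * => n2 IHn.
have : (1 - r) * (1 + r) * (N + 1) <= 4; last by nra.
nra.
Qed.

Lemma sqrt_maj_lim e : 0 < e -> exists n, 1 - sqrt_maj n <= e.
Proof.
move=> e0; have [n _ ne] := near_infty_natSinv_lt (PosNum e0).
(* At this index the rate is [2 / (2 n + 2) = 1 / (n + 1)]. *)
exists (n * 2)%N; rewrite (le_trans (sqrt_maj_ge _))//.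
have /ltW := ne n (leqnn _); apply: le_trans => /=.
rewrite ler_pdivrMr ?ltr0n// ler_pdivlMl ?ltr0n//.
by rewrite -natrM ler_nat mulSn mulnC.
Qed.

Lemma bnd_halfZ x (M : R) : bnd x M -> bnd ((2^-1)%:C%C *: x) (M / 2).
Proof.
by move=> xM; rewrite mulrC -[2^-1 in X in bnd _ X]ger0_norm ?invr_ge0//; exact: bndZr.
Qed.

Lemma half_add x : (2^-1)%:C%C *: x + (2^-1)%:C%C *: x = x.
Proof.
by rewrite -scalerDl -rmorphD/= (_ : 2^-1 + 2^-1 = 1 :> R) ?scale1r//; field.
Qed.

Lemma mulrB_sqr (y z : U) : y * y - z * z = y * (y - z) + (y - z) * z.
Proof. by rewrite mulrBr mulrBl addrA subrK. Qed.

Lemma bnd_sqrt_seq x n : bnd x 1 -> bnd (sqrt_seq x n) (sqrt_maj n).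
Proof.
move=> x1; elim: n => [|n IHn] /=; first exact: bnd0.
have /andP[r0 _] := sqrt_maj_itv n.
by apply: bnd_halfZ; apply: bndD => //; rewrite expr2; exact: bndM.
Qed.

(** Both recursions have increments given by [y^2 - z^2 = y (y - z) + (y - z) z], so the scalar ones
    majorize by induction. *)
Lemma bnd_sqrt_seqS x n : bnd x 1 ->
  bnd (sqrt_seq x n.+1 - sqrt_seq x n) (sqrt_maj n.+1 - sqrt_maj n).
Proof.
move=> x1; elim: n => [|n IHn].
  by rewrite /= !mulr0 !addr0 !subr0 expr0n addr0; exact: bnd_halfZ.
have -> : sqrt_seq x n.+2 - sqrt_seq x n.+1 = (2^-1)%:C%C *:
    (sqrt_seq x n.+1 * (sqrt_seq x n.+1 - sqrt_seq x n) +
     (sqrt_seq x n.+1 - sqrt_seq x n) * sqrt_seq x n).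
  rewrite -mulrB_sqr [sqrt_seq x n.+2]/= {3}[sqrt_seq x n.+1]/= -scalerBr.
  by rewrite opprD addrACA subrr add0r.
have -> : sqrt_maj n.+2 - sqrt_maj n.+1 =
   (sqrt_maj n.+1 * (sqrt_maj n.+1 - sqrt_maj n) +
    (sqrt_maj n.+1 - sqrt_maj n) * sqrt_maj n) / 2.
  by rewrite /=; field.
have /andP[r0 _] := sqrt_maj_itv n.+1.
apply: bnd_halfZ; apply: bndD; apply: bndM => //.
- exact: bnd_sqrt_seq.
- by rewrite subr_ge0 sqrt_maj_le.
- exact: bnd_sqrt_seq.
Qed.

Lemma bnd_sqrt_seqB x n m : bnd x 1 -> (n <= m)%N ->
  bnd (sqrt_seq x m - sqrt_seq x n) (1 - sqrt_maj n).
Proof.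
move=> x1 nm; apply: (@bnd_le _ _ _ (sqrt_maj m - sqrt_maj n)).
  by rewrite lerD2r; have /andP[] := sqrt_maj_itv m.
rewrite -(subnK nm); elim: (m - n)%N => [|k IHk].
  by rewrite add0n !subrr; exact: bnd0.
rewrite addSn -(subrK (sqrt_seq x (k + n)) (sqrt_seq x (k + n).+1)) -addrA.
rewrite -(subrK (sqrt_maj (k + n)) (sqrt_maj (k + n).+1)) -[_ - sqrt_maj n in X in bnd _ X]addrA.
by apply: bndD IHk; exact: bnd_sqrt_seqS.
Qed.

Lemma comm_sqrt_seq x z n : GRing.comm z x -> GRing.comm z (sqrt_seq x n).
Proof.
move=> zx; elim: n => [|n IHn] /=; first exact: commr0.
rewrite /GRing.comm -scalerAr -scalerAl; congr (_ *: _).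
by apply: commrD => //; exact: commrM.
Qed.

Lemma bnd_subr_eq x y : (forall e : R, 0 < e -> bnd (x - y) e) -> x = y.
Proof.
move=> xy; apply/eqP; rewrite -subr_eq0; apply/eqP/bnd_eq0/bnd_lim => e e0.
by rewrite add0r; exact: xy.
Qed.

Lemma ustar_sqrt_seq x n : ustar x = x -> ustar (sqrt_seq x n) = sqrt_seq x n.
Proof.
by move=> xs; elim: n => [|n IHn] /=; rewrite ?ustar0// ustarZr ustarD ustarM IHn xs.
Qed.

(** [y] is the limit of [sqrt_seq x], and [1 - y] is the square root of [1 - x]. Self-adjointness
    and the commutation clause are inherited from the sequence. *)
Lemma one_sub_sqrt x : bnd x 1 -> exists y,
  [/\ (1 - y) * (1 - y) = 1 - x, bnd y 1,
      forall n, bnd (y - sqrt_seq x n) (1 - sqrt_maj n),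
      ustar x = x -> ustar y = y &
      forall z, GRing.comm z x -> GRing.comm z y].
Proof.
move=> x1; have [//|e e0|y yx] := @bnd_complete (sqrt_seq x) (fun n => 1 - sqrt_maj n).
- by move=> n m; exact: bnd_sqrt_seqB.
- exact: sqrt_maj_lim.
have y1 : bnd y 1 by have := yx 0%N; rewrite /= !subr0.
exists y; split=> //.
(* The fixed point equation of the recursion; it is equivalent to [(1 - y)^2 = 1 - x]. *)
- have yy : y + y = x + y * y.
    apply: bnd_subr_eq => e e0.
    have e4 : 0 < e / 4%:R by rewrite divr_gt0.
    have [n ne] := sqrt_maj_lim e4.
    have ge0 m : 0 <= 1 - sqrt_maj m by rewrite subr_ge0; have /andP[] := sqrt_maj_itv m.
    set s := sqrt_seq x.
    have sE : x + s n * s n = s n.+1 + s n.+1.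
      by rewrite /s /= half_add.
    have -> : y + y - (x + y * y) = (y - s n.+1) + (y - s n.+1) - (y * y - s n * s n).
      rewrite addrACA -opprD -sE !opprD opprK addrA -!addrA; congr (_ + (_ + (_ + _))).
      by rewrite addrCA addNr addr0.
    apply: (@bnd_le _ _ _ ((1 - sqrt_maj n.+1) + (1 - sqrt_maj n.+1) +
        (1 * (1 - sqrt_maj n) + (1 - sqrt_maj n) * 1))).
      by have := sqrt_maj_le n; move: ne; lra.
    apply: bndB; first by apply: bndD; exact: yx.
    rewrite mulrB_sqr; apply: bndD; apply: bndM => //; try exact: yx.
    apply: bnd_le (bnd_sqrt_seq _ x1).
    by have /andP[] := sqrt_maj_itv n.
  rewrite mulrBr mulr1 mulrBl mul1r opprB addrA addrAC.
  by rewrite -(addrA 1) -opprD yy opprD addrA subrK.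
- move=> xs; apply: bnd_subr_eq => e e0.
  have e2 : 0 < e / 2 by rewrite divr_gt0.
  have [n ne] := sqrt_maj_lim e2.
  rewrite [e]splitr -(subrK (sqrt_seq x n) (ustar y)) -addrA.
  have ge0 : 0 <= 1 - sqrt_maj n by rewrite subr_ge0; have /andP[] := sqrt_maj_itv n.
  apply: bndD; last by apply: bnd_le ne _; apply: bnd_distrC.
  rewrite -{1}(ustar_sqrt_seq n xs) -ustarB; apply: bnd_le ne _.
  exact: bnd_ustar.
- move=> z zx; have [M M0 zM] := bnd_exists z.
  apply: bnd_subr_eq => e e0.
  have e2 : 0 < e / 2 / (M + 1) by rewrite !divr_gt0// ltr_pwDr.
  have [n ne] := sqrt_maj_lim e2.
  have ge0 : 0 <= 1 - sqrt_maj n by rewrite subr_ge0; have /andP[] := sqrt_maj_itv n.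
  have -> : z * y - y * z = z * (y - sqrt_seq x n) - (y - sqrt_seq x n) * z.
    by rewrite mulrBr mulrBl (comm_sqrt_seq n zx) opprB addrA subrK.
  apply: (@bnd_le _ _ _ (M * (1 - sqrt_maj n) + (1 - sqrt_maj n) * M)).
    move: ne; rewrite -mulrA -invfM ler_pdivlMr ?mulr_gt0 ?ltr_pwDr//; nra.
  by apply: bndB; apply: bndM.
Qed.

End SquareRoot.

(** * Positivity *)

Section Positivity.
Context {R : realType} {A : cstarAlgType R}.
Local Notation U := (unitization A).
Implicit Types (x y z a r s : U) (t M : R).

Lemma ustar_real t : ustar (t%:C%C%:A : U) = t%:C%C%:A.
Proof. by rewrite ustarZr ustar1. Qed.

Lemma ustarZi x : ustar ('i%C *: x) = - ('i%C *: ustar x).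
Proof. by rewrite ustarZ -scaleNr; congr (_ *: _); apply/eqP; rewrite eq_complex/= oppr0 !eqxx. Qed.

Lemma mulii : 'i%C * 'i%C = -1 :> R[i].
Proof. by rewrite -expr2 sqr_i. Qed.

Lemma scaleii x : 'i%C *: ('i%C *: x) = - x.
Proof. by rewrite scalerA mulii scaleN1r. Qed.

Lemma bnd_Zi x M : bnd ('i%C *: x) M -> bnd x M.
Proof. by move=> /bndZi/bndN; rewrite scaleii opprK. Qed.

Lemma ustar_cartesian r s : ustar r = r -> ustar s = s -> GRing.comm r s ->
  ustar (r + 'i%C *: s) * (r + 'i%C *: s) = r * r + s * s.
Proof.
move=> rs ss rsC; rewrite ustarD ustarZi rs ss mulrBl !mulrDr -!scalerAr -!scalerAl.
by rewrite scaleii -rsC opprD opprK addrA addrK.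
Qed.

(** The element [w = r + i s] satisfies [w^* w = t^2], so it is bounded by [t], and
    [2 i s = w - w^*]. *)
Lemma bnd_sum_sqr r s t : 0 <= t -> ustar r = r -> ustar s = s ->
  GRing.comm r s -> r * r + s * s = (t ^+ 2)%:C%C%:A -> bnd s t.
Proof.
move=> t0 rs ss rsC rst; pose w := r + 'i%C *: s.
have wt : bnd w t.
  apply: bnd_cstar => //; rewrite ustar_cartesian// rst.
  by rewrite -[X in bnd _ X]ger0_norm ?sqr_ge0//; exact: bnd_real.
apply: bnd_Zi; apply: bnd_half.
have -> : 'i%C *: s + 'i%C *: s = w - ustar w.
  by rewrite ustarD ustarZi rs ss opprD opprK addrACA subrr add0r.
by apply: bndB => //; exact: bnd_ustar.
Qed.

(** The root [r] of [1 - s^2] has [s^2 + r^2 = 1], so [r] is a contraction, and so is [r^2]. *)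
Lemma bnd_one_sub_sqr s : ustar s = s -> bnd s 1 -> bnd (1 - s * s) 1.
Proof.
move=> ss s1; have ss1 : bnd (s * s) 1.
  by rewrite -[1](mulr1 1); exact: bndM.
have [y [y2 _ _ ys yC]] := one_sub_sqrt ss1.
have {}ys : ustar (1 - y) = 1 - y by rewrite ustarB ustar1 ys// ustarM ss.
have {}yC : GRing.comm s (1 - y).
  by apply: commrB; [exact: commr1|apply: yC; exact: commrM].
rewrite -y2 -[1 in X in bnd _ X](mulr1 1).
suff: bnd (1 - y) 1 by move=> ?; exact: bndM.
apply: (bnd_sum_sqr ler01 ss ys yC).
by rewrite y2 addrC subrK expr1n scale1r.
Qed.

(** Here [- s^2 = 1 - (1 + s^2)] has a root [r], so [r^2 + s^2 = 0] and [bnd_sum_sqr] applies with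
    [t = 0]. *)
Lemma bnd_one_add_sqr s : ustar s = s -> bnd (1 + s * s) 1 -> s = 0.
Proof.
move=> ss s1; have [y [y2 _ _ ys yC]] := one_sub_sqrt s1.
apply: bnd_eq0; apply: (@bnd_sum_sqr (1 - y)) => //.
- by rewrite ustarB ustar1 ys// ustarD ustar1 ustarM ss.
- apply/commr_sym/commrB; first exact: commr1.
  by apply: yC; apply: commrD; [exact: commr1|exact: commrM].
- by rewrite y2 expr0n scale0r opprD addrA subrr sub0r addNr.
Qed.

Lemma bnd_sa_pow2 x M k : 0 <= M -> ustar x = x ->
  bnd (x ^+ (2 ^ k)) (M ^+ (2 ^ k)) -> bnd x M.
Proof.
move=> M0 xs; have xns n : ustar (x ^+ n) = x ^+ n.
  by elim: n => [|n IHn]; rewrite ?ustar1// {1}exprSr ustarM xs IHn exprS.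
elim: k => [|k IHk]; first by rewrite !expr1.
rewrite expnS mulnC !exprM expr2 => xM; apply: IHk.
by apply: bnd_sa_sqr => //; exact: exprn_ge0.
Qed.

Lemma linear_le_expr2 (C e : R) : 0 <= C -> 0 < e ->
  exists k, (2 ^ k)%N%:R * C + 1 <= (1 + e) ^+ (2 ^ k).
Proof.
move=> C0 e0; have bernoulli n : 1 + n%:R * e <= (1 + e) ^+ n.
  elim: n => [|n IHn]; first by rewrite mul0r addr0.
  rewrite exprS -natr1; have : 0 <= n%:R * e by rewrite mulr_ge0// ltW.
  nra.
(* Bernoulli's bound [1 + m e] at [m = 2^k] is squared; its quadratic term [m^2 e^2] exceeds [2 m C]
   once [2 C <= m e^2]. *)
pose k := Num.bound (2 * C / e ^+ 2); exists k.+1.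
have kC : 2 * C <= (2 ^ k)%N%:R * e ^+ 2.
  rewrite -ler_pdivrMr ?exprn_gt0// (le_trans (ltW (archi_boundP _)))//.
    by rewrite divr_ge0 ?mulr_ge0 ?exprn_ge0// ltW.
  by rewrite ler_nat ltnW// ltn_expl.
have := bernoulli (2 ^ k)%N; rewrite expnS mulnC exprM natrM.
set m := ((2 ^ k)%N%:R : R) in kC *; set E := (1 + e) ^+ _ => mE.
have m0 : 0 <= m by rewrite ler0n.
have : (1 + m * e) ^+ 2 <= E ^+ 2.
  by rewrite ler_sqr ?nnegrE// ?(le_trans _ mE) ?addr_ge0 ?mulr_ge0// ltW.
apply: le_trans.
have : 0 <= m * e by rewrite mulr_ge0// ltW.
nra.
Qed.

(* The norm of a self-adjoint element is its spectral radius. *)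
Lemma bnd_sa_growth x (C : R) : 0 <= C -> ustar x = x ->
  (forall n, bnd (x ^+ n) (n%:R * C + 1)) -> bnd x 1.
Proof.
move=> C0 xs xn; apply: bnd_lim => e e0.
have [k kC] := linear_le_expr2 C0 e0.
apply: (@bnd_sa_pow2 _ _ k) => //; first by rewrite addr_ge0// ltW.
exact: bnd_le kC (xn _).
Qed.

(* The spectra of [x^* x] and [x x^*] agree away from 0. *)
Lemma bnd_one_sub_ustarC x : bnd (1 - x * ustar x) 1 -> bnd (1 - ustar x * x) 1.
Proof.
move=> x1; have [M M0 xM] := bnd_exists x.
(* The witness [s] is the sum of the first [n] powers of [1 - x x^*], each a contraction; hence the
   powers of [1 - x^* x] grow at most linearly. *)
have : forall n, exists2 s, bnd s n%:R & (1 - ustar x * x) ^+ n = 1 - ustar x * s * x.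
  elim=> [|n [s sn xn]].
    by exists 0; [exact: bnd0|rewrite mulr0 mul0r subr0].
  exists (1 + s * (1 - x * ustar x)).
    by rewrite -natr1 [n%:R + 1]addrC; apply: bndD; [exact: bnd1|rewrite -[n%:R]mulr1; exact: bndM].
  rewrite exprSr xn mulrBl mul1r [in LHS]mulrBr mulr1 [in RHS]mulrDr mulr1.
  by rewrite mulrDl (mulrBr s) mulr1 (mulrBr (ustar x)) (mulrBl x) !mulrA !opprD !addrA.
move=> xn; apply: (@bnd_sa_growth _ (M * M)); first exact: mulr_ge0.
  by rewrite ustarB ustar1 ustarM ustarK.
move=> n; have [s sn ->] := xn n; rewrite [_ + 1]addrC; apply: bndB; first exact: bnd1.
rewrite mulrA (mulrC n%:R); apply: bndM => //; first by rewrite mulr_ge0.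
by apply: bndM => //; exact: bnd_ustar.
Qed.

(** The Jordan decomposition: [q] and [m] are the halves of [|a| + a] and [|a| - a], where [|a|] is
    the root of [a^2]. The two final bounds express the positivity of [m] and of [|a| = q + m]. *)
Lemma sa_decomposition a : ustar a = a -> bnd a 1 -> exists q m,
  [/\ a = q - m, ustar m = m /\ q * m = 0, m * q = 0,
      bnd (1 - m) 1 & bnd (1 - (q + m)) 1].
Proof.
move=> aa a1; have [y [y2 y1 _ ys yC]] := one_sub_sqrt (bnd_one_sub_sqr aa a1).
set p := 1 - y in y2.
have pp : p * p = a * a by rewrite y2 opprB addrC subrK.
have ps : ustar p = p by rewrite ustarB ustar1 ys// ustarB ustar1 ustarM aa.
have ap : a * p = p * a.
  apply: commrB; first exact: commr1.
  by apply: yC; apply: commrB; [exact: commr1|exact: commrM].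
have p1 : bnd (1 - p) 1 by rewrite opprB addrC subrK.
clearbody p; pose h := (2^-1)%:C%C : R[i].
pose m := h *: (p - a); pose q := h *: (p + a).
have qm : q * m = 0.
  by rewrite /q /m -scalerAr -scalerAl mulrBr !mulrDl pp ap (addrC (a * a)) subrr !scaler0.
have mq : m * q = 0.
  by rewrite /q /m -scalerAr -scalerAl mulrBl !mulrDr pp ap (addrC (a * a)) subrr !scaler0.
have qDm : q + m = p.
  by rewrite -scalerDr addrACA subrr addr0 scalerDr half_add.
have qBm : q - m = a.
  by rewrite -scalerBr opprB addrC addrA subrK scalerDr half_add.
have ms : ustar m = m by rewrite /m ustarZr ustarB ps aa.
exists q, m; split=> //; last by rewrite qDm.
have mp : GRing.comm m p by rewrite /GRing.comm -qDm mulrDl mulrDr mq qm.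
have mm : m * (1 - m) = m * (1 - p).
  by rewrite -qDm !mulrBr mulrDr mq add0r.
(* Since [m q = 0], the elements [1 - m] and [1 - p] agree after multiplication by [m]. As [1 - p]
   is a contraction, the powers of [1 - m] grow at most linearly. *)
have mn n : m * (1 - m) ^+ n = m * (1 - p) ^+ n.
  elim: n => // n IHn; rewrite exprSr mulrA IHn -mulrA.
  have mC : GRing.comm (1 - m) (1 - p) by
    apply: commrB; [exact: commr1|apply/commr_sym/commrB; [exact: commr1|exact/commr_sym]].
  rewrite -(commrX n mC) mulrA mm -mulrA; congr (_ * _).
  by rewrite exprS.
have [M M0 mM] := bnd_exists m.
apply: (@bnd_sa_growth _ M) => //; first by rewrite ustarB ustar1 ms.
elim=> [|n IHn]; first by rewrite mul0r add0r; exact: bnd1.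
rewrite exprS mulrBl mul1r mn -natr1 mulrDl mul1r addrAC.
apply: bndB => //; rewrite -[M]mulr1; apply: bndM => //.
elim: n {IHn} => [|n IHn]; first exact: bnd1.
by rewrite exprS -[1 in X in bnd _ X](mulr1 1); apply: bndM.
Qed.

(** For self-adjoint [z] the bound places the spectrum in [[0, 2 t]]. In this form positivity is
    visibly stable under sums, and [x^* x] is shown to have it only in [upos_ustar_mul]. *)
Definition upos z := ustar z = z /\ exists2 t : R, 0 <= t & bnd (t%:C%C%:A - z) t.

Lemma upos0 : upos (0 : U).
Proof. by split; [exact: ustar0|exists 0 => //; rewrite scale0r subr0; exact: bnd0]. Qed.

Lemma uposD x y : upos x -> upos y -> upos (x + y).
Proof.
move=> [xs [t t0 xt]] [ys [u u0 yu]]; split; first by rewrite ustarD xs ys.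
exists (t + u); first exact: addr_ge0.
by rewrite rmorphD/= scalerDl opprD addrACA; exact: bndD.
Qed.

Lemma uposZ x (c : R) : 0 <= c -> upos x -> upos (c%:C%C *: x).
Proof.
move=> c0 [xs [t t0 xt]]; split; first by rewrite ustarZr xs.
exists (c * t); first exact: mulr_ge0.
by rewrite rmorphM/= -scalerA -scalerBr -{2}(ger0_norm c0); exact: bndZr.
Qed.

Lemma upos_bound x t : ustar x = x -> bnd x t -> 0 <= t -> upos (t%:C%C%:A - x).
Proof.
move=> xs xt t0; split; first by rewrite ustarB ustar_real xs.
by exists t => //; rewrite opprB addrC subrK.
Qed.

Lemma upos_sqr s : ustar s = s -> upos (s * s).
Proof.
move=> ss; have [M M0 sM] := bnd_exists s.
have M1 : 0 < M + 1 by rewrite ltr_pwDr.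
have s1 : bnd (((M + 1)^-1)%:C%C *: s) 1.
  have Mi0 : 0 <= (M + 1)^-1 by rewrite invr_ge0 ltW.
  apply: (@bnd_le _ _ _ (`|(M + 1)^-1| * (M + 1))).
    by rewrite ger0_norm// mulVf// gt_eqF.
  by apply: bndZr; apply: bnd_le sM; rewrite lerDl.
split; first by rewrite ustarM ss.
exists ((M + 1) ^+ 2); first exact: sqr_ge0.
rewrite -[X in bnd _ X]ger0_norm ?sqr_ge0// -[X in bnd _ X]mulr1.
have -> : ((M + 1) ^+ 2)%:C%C%:A - s * s = ((M + 1) ^+ 2)%:C%C *:
    (1 - (((M + 1)^-1)%:C%C *: s) * (((M + 1)^-1)%:C%C *: s)).
  rewrite scalerBr -scalerAr -scalerAl !scalerA -!rmorphM/=.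
  by rewrite -mulrA -invfM -expr2 mulfV ?scale1r// expf_neq0// gt_eqF.
by apply: bndZr; apply: bnd_one_sub_sqr => //; rewrite ustarZr ss.
Qed.

(** After scaling, [z / t] is [1 - (1 - z / t)] and [one_sub_sqrt] applies. The commutation clause
    lets roots of commuting elements commute. *)
Lemma upos_sqrt z : upos z -> exists r, [/\ ustar r = r, r * r = z &
  forall w, GRing.comm w z -> GRing.comm w r].
Proof.
move=> [zs [t]]; rewrite le_eqVlt => /predU1P[<-|t0 zt].
  rewrite scale0r sub0r => /bndN; rewrite opprK => /bnd_eq0 ->.
  by exists 0; split; rewrite ?ustar0 ?mulr0// => w _; exact: commr0.
have ti0 : 0 <= t^-1 by rewrite invr_ge0 ltW.
have x1 : bnd (1 - (t^-1)%:C%C *: z) 1.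
  apply: (@bnd_le _ _ _ (`|t^-1| * t)); first by rewrite ger0_norm// mulVf// gt_eqF.
  rewrite (_ : 1 - _ = (t^-1)%:C%C *: (t%:C%C%:A - z)); first exact: bndZr.
  by rewrite scalerBr scalerA -rmorphM/= mulVf ?gt_eqF// scale1r.
have [y [y2 _ _ ys yC]] := one_sub_sqrt x1.
exists ((Num.sqrt t)%:C%C *: (1 - y)); split.
- by rewrite ustarZr ustarB ustar1 ys// ustarB ustar1 ustarZr zs.
- rewrite -scalerAr -scalerAl scalerA -rmorphM/= -expr2 sqr_sqrtr ?(ltW t0)// y2.
  by rewrite opprB addrC subrK scalerA -rmorphM/= mulfV ?gt_eqF// scale1r.
- move=> w wz; rewrite /GRing.comm -scalerAr -scalerAl; congr (_ *: _).
  apply: commrB; first exact: commr1.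
  apply: yC; apply: commrB; first exact: commr1.
  by rewrite /GRing.comm -scalerAr -scalerAl wz.
Qed.

End Positivity.

(** * Positivity of [x^* x], order bounds and discriminants *)

Section PositiveCone.
Context {R : realType} {A : cstarAlgType R}.
Local Notation U := (unitization A).
Implicit Types (x y z r s P Q X Y Z : U) (t M : R).

(** The scaling factor is a square so that it can be shared between the two factors of a product. *)
Lemma upos_normalize z : upos z -> exists2 c : R, 0 < c & bnd (1 - (c ^+ 2)%:C%C *: z) 1.
Proof.
move=> [_ [t t0 zt]]; have t1 : 0 < t + 1 by rewrite ltr_pwDr.
exists (Num.sqrt (t + 1)^-1); first by rewrite sqrtr_gt0 invr_gt0.
rewrite sqr_sqrtr ?invr_ge0 ?(ltW t1)//.
apply: (@bnd_le _ _ _ (`|(t + 1)^-1| * (t + 1))).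
  by rewrite ger0_norm ?invr_ge0 ?(ltW t1)// mulVf// gt_eqF.
rewrite (_ : 1 - _ = ((t + 1)^-1)%:C%C *: ((t + 1)%:C%C%:A - z)).
  apply: bndZr; rewrite rmorphD/= scalerDl scale1r addrAC.
  by apply: bndD => //; exact: bnd1.
by rewrite scalerBr scalerA -rmorphM/= mulVf ?gt_eqF// scale1r.
Qed.

Lemma upos_denormalize (c : R) z : 0 < c -> ustar z = z ->
  bnd (1 - (c ^+ 2)%:C%C *: z) 1 -> upos z.
Proof.
move=> c0 zs z1; have c2 : 0 < c ^+ 2 by rewrite exprn_gt0.
have := @uposZ _ _ ((c ^+ 2)%:C%C *: z) (c ^+ 2)^-1.
rewrite scalerA -rmorphM/= mulVf ?gt_eqF// scale1r; apply.
  by rewrite invr_ge0 ltW.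
split; first by rewrite ustarZr zs.
by exists 1; rewrite ?ler01// scale1r.
Qed.

Lemma mulZZ (c : R) x y : (c%:C%C *: x) * (c%:C%C *: y) = (c ^+ 2)%:C%C *: (x * y).
Proof. by rewrite -scalerAr -scalerAl scalerA -rmorphM/= expr2. Qed.

Lemma upos_ustarC x : upos (x * ustar x) -> upos (ustar x * x).
Proof.
move=> /upos_normalize[c c0 xc]; apply: (upos_denormalize c0).
  by rewrite ustarM ustarK.
rewrite -mulZZ -ustarZr; apply: bnd_one_sub_ustarC.
by rewrite ustarZr mulZZ.
Qed.

Lemma upos_opp_sqr s : ustar s = s -> upos (- (s * s)) -> s = 0.
Proof.
move=> ss /upos_normalize[c c0]; rewrite scalerN opprK -mulZZ => sc.
have /eqP := bnd_one_add_sqr (esym (esym (etrans (ustarZr c s) (congr1 _ ss)))) sc.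
rewrite scaler_eq0 => /orP[/eqP/complexI c00|/eqP//].
by rewrite c00 ltxx in c0.
Qed.

(* Kaplansky's argument: if [m] is the negative part of [x^* x] and [b = x m],
   then [b^* b = - m^3 <= 0], while [b b^* + b^* b >= 0] always. *)
Lemma upos_ustar_mul x : upos (ustar x * x).
Proof.
have [M M0 xM] := bnd_exists x.
wlog x1 : x M M0 xM / bnd x 1.
  move=> xx; have M1 : 0 < M + 1 by rewrite ltr_pwDr.
  have Mi0 : 0 < (M + 1)^-1 by rewrite invr_gt0.
  have x1 : bnd (((M + 1)^-1)%:C%C *: x) 1.
    apply: (@bnd_le _ _ _ (`|(M + 1)^-1| * (M + 1))).
      by rewrite ger0_norm ?(ltW Mi0)// mulVf// gt_eqF.
    by apply: bndZr; apply: bnd_le xM; rewrite lerDl.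
  have := xx _ _ ler01 x1 x1; rewrite ustarZr mulZZ => /(uposZ (sqr_ge0 (M + 1))).
  rewrite scalerA -rmorphM/= exprVn mulfV ?scale1r//.
  by rewrite expf_neq0// gt_eqF.
have ss : ustar (ustar x * x) = ustar x * x by rewrite ustarM ustarK.
have s1 : bnd (ustar x * x) 1.
  by rewrite -[1](mulr1 1); apply: bndM => //; exact: bnd_ustar.
have [q [m [xx [ms qm] mq m1 qm1]]] := sa_decomposition ss s1.
have mpos : upos m by split=> //; exists 1; rewrite ?ler01// scale1r.
have [s [sa sm sC]] := upos_sqrt mpos.
have sms : GRing.comm m s by exact: sC.
pose b := x * m; pose c := s * m.
have cs : ustar c = c by rewrite ustarM sa ms sms.
have cc : c * c = m * m * m by rewrite /c mulrA -(mulrA s) sms mulrA sm.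
have bb : ustar b * b = - (c * c).
  rewrite ustarM ms mulrA -(mulrA m) xx mulrBr mq sub0r mulNr.
  by rewrite cc.
have bbC : upos (b * ustar b).
  (* Up to sign, [u] and [v] are twice the real and imaginary parts of [b], so
     [u^2 + v^2 = 2 (b b^* + b^* b)]. *)
  pose u := b + ustar b; pose v := 'i%C *: (b - ustar b).
  have us : ustar u = u by rewrite ustarD ustarK addrC.
  have vs : ustar v = v by rewrite ustarZi ustarB ustarK -scalerN opprB.
  have uv : u * u + v * v = (b * ustar b + b * ustar b) - (c * c + c * c).
    rewrite /u /v -scalerAr -scalerAl scaleii opprD -bb.
    ncring.
  have : upos (b * ustar b + b * ustar b).
    rewrite -[X in upos X](subrK (c * c + c * c)) -uv.
    by do 2![apply: uposD]; exact: upos_sqr.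
  move=> /(@uposZ _ _ _ (2^-1)); rewrite scalerDr half_add; apply.
  by rewrite invr_ge0.
have c0 : c = 0.
  by apply: upos_opp_sqr => //; rewrite -bb; exact: upos_ustarC.
(* [m^4 = c^2 m = 0], and the norm of a self-adjoint element is controlled by that of its square,
   used twice. *)
have m0 : m = 0.
  apply: bnd_eq0; apply: bnd_sa_sqr => //; apply: bnd_sa_sqr => //.
  - by rewrite ustarM ms.
  - by rewrite mulrA -cc c0 !mul0r expr0n/= expr0n; exact: bnd0.
split=> //; exists 1; rewrite ?ler01// scale1r xx.
by rewrite m0 subr0; move: qm1; rewrite m0 addr0.
Qed.

Lemma upos_conj x z : upos z -> upos (ustar x * z * x).
Proof.
move=> /upos_sqrt[r [rs <- _]].
rewrite (_ : _ * _ = ustar (r * x) * (r * x)); first exact: upos_ustar_mul.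
by rewrite ustarM rs !mulrA.
Qed.

Lemma comm_real t z : GRing.comm z (t%:C%C%:A).
Proof. by rewrite /GRing.comm -scalerAr -scalerAl mulr1 mul1r. Qed.

(** With [r] and [s] the commuting roots of [t - P] and [t + P], one has [(r s)^2 + P^2 = t^2], and
    [bnd_sum_sqr] applies. *)
Lemma upos_bnd P t : 0 <= t -> upos (t%:C%C%:A - P) -> upos (t%:C%C%:A + P) -> bnd P t.
Proof.
move=> t0 tBP tDP.
have Ps : ustar P = P.
  by case: tDP => + _; rewrite ustarD ustar_real => /addrI.
have [r [rs rr rC]] := upos_sqrt tBP; have [s [sa ss sC]] := upos_sqrt tDP.
have Pr : GRing.comm P r by apply: rC; apply: commrB; [exact: comm_real|].
have Ps' : GRing.comm P s by apply: sC; apply: commrD; [exact: comm_real|].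
have rsC : GRing.comm r s.
  by apply: sC; apply: commrD; [exact: comm_real|exact: commr_sym].
apply: (@bnd_sum_sqr _ _ (r * s)) => //.
- by rewrite ustarM rs sa rsC.
- by apply: commr_sym; exact: commrM.
- have -> : r * s * (r * s) = (t%:C%C%:A - P) * (t%:C%C%:A + P).
    by rewrite mulrA -(mulrA r) -rsC mulrA rr -mulrA ss.
  transitivity (t%:C%C%:A * t%:C%C%:A + (t%:C%C%:A * P - P * t%:C%C%:A) : U); first ncring.
  by rewrite comm_real subrr addr0 -scalerAr mulr1 scalerA -rmorphM/= -expr2.
Qed.

Lemma uposB_bnd P Q t : 0 <= t -> upos P -> upos (Q - P) -> bnd Q t -> bnd P t.
Proof.
move=> t0 P0 PQ Qt; have Qs : ustar Q = Q.
  by case: PQ => + _; rewrite ustarB; case: P0 => -> _ /addIr.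
apply: upos_bnd => //.
  by rewrite -(subrK Q t%:C%C%:A) -addrA; apply: uposD => //; exact: upos_bound.
apply: uposD => //; rewrite -[X in upos X]subr0.
by apply: upos_bound => //; [exact: ustar0|exact: bnd_le t0 bnd0].
Qed.

(** An operator form of the discriminant inequality. For [k] of modulus [1 / M] the outer terms sum
    to at most 2; [k = 1 / M] and [k = i / M], with their opposites, then bound [Z + Z^*] and
    [Z - Z^*] by [2 M]. *)
Lemma bnd_discriminant X Y Z M : 0 < M -> ustar X = X -> ustar Y = Y ->
  bnd X (M ^+ 2) -> bnd Y 1 ->
  (forall k : R[i], upos ((k * (k^*)%C) *: X + (k *: Z + (k^*)%C *: ustar Z) + Y)) ->
  bnd Z (2 * M).
Proof.
move=> M0 Xs Ys XM Y1 pos.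
pose t := M^-1; have t0 : 0 < t by rewrite invr_gt0.
have Xt : bnd ((t ^+ 2)%:C%C *: X + Y) 2.
  rewrite -[2]/(1 + 1); apply: bndD => //.
  apply: (@bnd_le _ _ _ (`|t ^+ 2| * M ^+ 2)); last exact: bndZr.
  by rewrite ger0_norm ?sqr_ge0// -exprMn mulVf ?expr1n// gt_eqF.
have XYs : ustar ((t ^+ 2)%:C%C *: X + Y) = (t ^+ 2)%:C%C *: X + Y.
  by rewrite ustarD ustarZr Xs Ys.
have key (k : R[i]) V : k * (k^*)%C = (t ^+ 2)%:C%C ->
    k *: Z + (k^*)%C *: ustar Z = t%:C%C *: V -> bnd V (2 * M).
  move=> kk kZ.
  have tV : bnd (t%:C%C *: V) 2.
    rewrite -kZ; apply: upos_bnd => //.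
      have := pos (- k); rewrite rmorphN/= mulrNN kk !scaleNr => pk.
      suff -> : 2%:C%C%:A - (k *: Z + (k^*)%C *: ustar Z) =
         (2%:C%C%:A - ((t ^+ 2)%:C%C *: X + Y)) +
         ((t ^+ 2)%:C%C *: X + (- (k *: Z) + - ((k^*)%C *: ustar Z)) + Y).
        by apply: uposD => //; exact: upos_bound.
      ncring.
    have := pos k; rewrite kk => pk.
    suff -> : 2%:C%C%:A + (k *: Z + (k^*)%C *: ustar Z) =
       (2%:C%C%:A - ((t ^+ 2)%:C%C *: X + Y)) +
       ((t ^+ 2)%:C%C *: X + (k *: Z + (k^*)%C *: ustar Z) + Y).
      by apply: uposD => //; exact: upos_bound.
    ncring.
  have -> : V = M%:C%C *: (t%:C%C *: V).
    by rewrite scalerA -rmorphM/= mulfV ?scale1r// gt_eqF.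
  by rewrite mulrC -{2}(ger0_norm (ltW M0)); exact: bndZr.
have reC (c : R) : (c%:C%C^*)%C = c%:C%C :> R[i].
  by apply/eqP; rewrite eq_complex/= oppr0 !eqxx.
have ReZ : bnd (Z + ustar Z) (2 * M).
  by apply: (key t%:C%C); rewrite reC -?scalerDr// -rmorphM/= -expr2.
have ImZ : bnd ('i%C *: (Z - ustar Z)) (2 * M).
  have itC : (('i%C * t%:C%C)^*)%C = - ('i%C * t%:C%C) :> R[i].
    by apply/eqP; rewrite eq_complex/= !(mul0r, mul1r, mulr0, subr0, addr0, oppr0) !eqxx.
  apply: (key ('i%C * t%:C%C)).
    by rewrite itC mulrN mulrACA mulii mulN1r opprK -rmorphM/= -expr2.
  by rewrite itC scaleNr -scalerBr scalerA mulrC.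
apply: bnd_half; have -> : Z + Z = (Z + ustar Z) + (Z - ustar Z) by ncring.
by apply: bndD => //; exact: bnd_Zi.
Qed.

(** The root taken in the unitization lies in [A], because the square of its scalar part is 0. *)
Lemma positive_eltP (a : A) : positive_elt a <-> upos (emb a).
Proof.
split=> [[x ->]|/upos_sqrt[r [rs ra _]]].
  by rewrite embM emb_star; exact: upos_ustar_mul.
have r0 : r.1 = 0.
  have /eqP : r.1 * r.1 = 0 by have := congr1 fst ra.
  by rewrite mulf_eq0 => /orP[] /eqP.
have rE : r = emb r.2 by case: (r) r0 => k b /= ->.
exists r.2; have -> : a = (emb a).2 by [].
by rewrite -ra rE -{1}rs {1}rE -emb_star -embM.
Qed.

End PositiveCone.

(** * Commutators with a square root *)

Section Commutator.
Context {R : realType} {A : cstarAlgType R}.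
Local Notation U := (unitization A).
Implicit Types (x y p H : U).

(** Each step of the recursion adds [d / 2]: the two terms of the commutator with [y^2] are halved
    back to one. *)
Lemma bnd_comm_sqrt_seq x H (d : R) n : bnd x 1 -> bnd (H * x - x * H) d ->
  bnd (H * sqrt_seq x n - sqrt_seq x n * H) (n%:R * d / 2).
Proof.
move=> x1 xd; elim: n => [|n IHn] /=.
  by rewrite mulr0 !mul0r subr0; exact: bnd0.
have yn : bnd (sqrt_seq x n) 1.
  by apply: bnd_le (bnd_sqrt_seq n x1); have /andP[] := @sqrt_maj_itv R n.
move: IHn yn; set y := sqrt_seq x n => IHn yn.
rewrite -scalerAr -scalerAl -scalerBr; apply: bnd_halfZ.
have -> : H * (x + y * y) - (x + y * y) * H =
  (H * x - x * H) + ((H * y - y * H) * y + y * (H * y - y * H)) by ncring.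
have d0 : 0 <= d by case: xd => + _; exact: le_trans (rnorm_ge0 _).
have nd0 : 0 <= n%:R * d / 2 by rewrite divr_ge0 ?mulr_ge0.
apply: (@bnd_le _ _ _ (d + (n%:R * d / 2 * 1 + 1 * (n%:R * d / 2)))).
  by rewrite -[n.+1%:R]natr1; lra.
by apply: bndD => //; apply: bndD; apply: bndM.
Qed.

(** A quantitative uniqueness of the positive root: [1 - p] is a contractive fixed point of the
    recursion for [1 - p^2], so the iterates approach it at the scalar rate. *)
Lemma bnd_one_sub_sqrt_seq p n : upos p -> bnd p 1 ->
  bnd (1 - p - sqrt_seq (1 - p * p) n) (1 - sqrt_maj n).
Proof.
move=> p0 p1; have ps : ustar p = p by case: p0.
have y1 : bnd (1 - p) 1.
  apply: (@uposB_bnd _ _ _ 1) => //; last exact: bnd1.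
    by have := upos_bound ps p1 (@ler01 R); rewrite scale1r.
  by rewrite opprB addrC subrK.
have x1 := bnd_one_sub_sqr ps p1.
elim: n => [|n IHn] /=; first by rewrite !subr0.
have -> : 1 - p - (2^-1)%:C%C *: (1 - p * p + sqrt_seq (1 - p * p) n * sqrt_seq (1 - p * p) n)
  = (2^-1)%:C%C *: ((1 - p) * (1 - p) - sqrt_seq (1 - p * p) n * sqrt_seq (1 - p * p) n).
  rewrite -[1 - p in LHS]half_add -scalerDr -scalerBr; congr (_ *: _).
  by set y := sqrt_seq _ n; ncring.
rewrite mulrB_sqr.
have -> : 1 - (1 + @sqrt_maj R n ^+ 2) / 2 =
  (1 * (1 - sqrt_maj n) + (1 - sqrt_maj n) * sqrt_maj n) / 2 by field.
have /andP[r0 r1] := @sqrt_maj_itv R n.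
apply: bnd_halfZ; apply: bndD; apply: bndM => //; first by rewrite subr_ge0.
exact: bnd_sqrt_seq.
Qed.

(** [p] is replaced by a polynomial in [p^2]. The first term is the commutator with that polynomial,
    the second twice the approximation error; [n] is left free to balance them. *)
Lemma bnd_commutator p H (d : R) n : upos p -> bnd p 1 -> bnd H 1 ->
  bnd (H * (p * p) - p * p * H) d ->
  bnd (H * p - p * H) (n%:R * d / 2 + 4 / n.+2%:R).
Proof.
move=> p0 p1 H1 pd; have ps : ustar p = p by case: p0.
have x1 := bnd_one_sub_sqr ps p1.
have xd : bnd (H * (1 - p * p) - (1 - p * p) * H) d.
  have -> : H * (1 - p * p) - (1 - p * p) * H = - (H * (p * p) - p * p * H) by ncring.
  exact: bndN.
have := bnd_comm_sqrt_seq n x1 xd; have := bnd_one_sub_sqrt_seq n p0 p1.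
set y := sqrt_seq _ n => yp yH.
have -> : H * p - p * H =
  - (H * y - y * H) + ((1 - p - y) * H - H * (1 - p - y)) by ncring.
apply: bndD; first exact: bndN.
have /andP[_ r1] := @sqrt_maj_itv R n.
apply: (@bnd_le _ _ _ ((1 - @sqrt_maj R n) * 1 + 1 * (1 - sqrt_maj n))).
  have -> : 4 / n.+2%:R = 2 / n.+2%:R + 2 / n.+2%:R :> R by rewrite -mulrDl -natrD.
  by rewrite mulr1 mul1r lerD// sqrt_maj_ge.
by apply: bndB; apply: bndM => //; rewrite subr_ge0.
Qed.

End Commutator.

(** * 2-positive maps *)

Section TwoPositive.
Context {R : realType} {A B : cstarAlgType R} (phi : {linear A -> B}).
Hypothesis phi2 : k_positive 2 phi.
Local Notation U := (unitization B).
Implicit Types (a b h x y : A) (c w : U).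
Local Notation F x := (emb (phi x)).

(** For [h = k^* k], the matrix with rows [(k, k y)] and 0 has the four arguments of [phi] as
    entries of its Gram matrix. The [u] and [v] are the columns of a matrix [Z] whose Gram matrix is
    the image. *)
Lemma two_positive_gram h y : positive_elt h -> exists u1 u2 v1 v2 : B,
  [/\ phi h = cstar u1 ** u1 + cstar u2 ** u2,
      phi (h ** y) = cstar u1 ** v1 + cstar u2 ** v2,
      phi (cstar y ** h) = cstar v1 ** u1 + cstar v2 ** u2 &
      phi (cstar y ** h ** y) = cstar v1 ** v1 + cstar v2 ** v2].
Proof.
move=> [k ->].
have [X [X00 X01 X1]] : exists X : 'M[A]_2, [/\ X ord0 ord0 = k,
    X ord0 ord_max = k ** y & forall l, X ord_max l = 0].
  exists (\matrix_(i, j)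
    (if i == ord0 then if j == ord0 then k else k ** y else 0)).
  by split=> [||l]; rewrite mxE.
have [Z ZX] : mxpositive (map_mx phi (mxcmul (mxcstar X) X)).
  by apply: phi2; exists X.
exists (Z ord0 ord0), (Z ord_max ord0), (Z ord0 ord_max), (Z ord_max ord_max).
have E i j : phi (cstar (X ord0 i) ** X ord0 j) =
    cstar (Z ord0 i) ** Z ord0 j + cstar (Z ord_max i) ** Z ord_max j.
  have := congr1 (fun M : 'M[B]_2 => M i j) ZX; rewrite !mxE.
  rewrite !(big_ord_recl, big_ord0) !addr0 !mxE.
  have -> : lift ord0 ord0 = ord_max :> 'I_2 by apply/val_inj.
  by rewrite !X1 cmul0r addr0.
split; rewrite -E ?X00 ?X01 ?cstarM ?cmulA//.
Qed.

Lemma two_positive_quadratic h y c w : positive_elt h ->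
  upos (ustar c * F (cstar y ** h ** y) * c - ustar c * F (cstar y ** h) * w
        - ustar w * F (h ** y) * c + ustar w * F h * w).
Proof.
move=> h0; have [u1 [u2 [v1 [v2 [-> -> -> ->]]]]] := two_positive_gram y h0.
rewrite !embD !embM !emb_star.
set V1 := emb v1; set V2 := emb v2; set U1 := emb u1; set U2 := emb u2.
pose z1 := V1 * c - U1 * w; pose z2 := V2 * c - U2 * w.
suff -> : ustar c * (ustar V1 * V1 + ustar V2 * V2) * c -
    ustar c * (ustar V1 * U1 + ustar V2 * U2) * w -
    ustar w * (ustar U1 * V1 + ustar U2 * V2) * c +
    ustar w * (ustar U1 * U1 + ustar U2 * U2) * w = ustar z1 * z1 + ustar z2 * z2.
  by apply: uposD; exact: upos_ustar_mul.
by rewrite /z1 /z2 !ustarB !ustarM; ncring.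
Qed.

Lemma two_positive_map : positive_map phi.
Proof.
move=> a a0; have [u1 [u2 [_ [_ [-> _ _ _]]]]] := two_positive_gram 0 a0.
by apply/positive_eltP; rewrite embD; apply: uposD; apply/positive_eltP; [exists u1|exists u2].
Qed.

(** Compatibility with the involution is read off the off-diagonal entries, hence only at products
    with a positive [h]. The factor is removed by a limit in [two_positive_star_limit] and by the
    unit in [unital_two_positive_star]. *)
Lemma two_positive_star h y : positive_elt h -> phi (cstar y ** h) = cstar (phi (h ** y)).
Proof.
move=> h0; have [u1 [u2 [v1 [v2 [_ -> -> _]]]]] := two_positive_gram y h0.
by rewrite cstarD !cstarM !cstarK.
Qed.

End TwoPositive.

(** * The estimate in [B] *)

Section Estimate.
Context {R : realType} {A B : cstarAlgType R} (phi : {linear A -> B}).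
Hypothesis phi2 : k_positive 2 phi.
Hypothesis phi1 : contractive phi.
Hypothesis phis : forall x, phi (cstar x) = cstar (phi x).
Local Notation F x := (emb (phi x)).
Implicit Types (M N e : R).

Lemma emb_mapD x y : F (x + y) = F x + F y. Proof. by rewrite linearD embD. Qed.
Lemma emb_mapB x y : F (x - y) = F x - F y. Proof. by rewrite linearB embB. Qed.
Lemma emb_mapZ (k : R[i]) x : F (k *: x) = k *: F x. Proof. by rewrite linearZ embZ. Qed.

Lemma ustar_emb_map x : ustar (F x) = F (cstar x).
Proof. by rewrite -emb_star phis. Qed.

Lemma bnd_emb_map x M : rnorm x <= M -> bnd (F x) M.
Proof.
by move=> xM; apply/bnd_emb; rewrite ?(le_trans (phi1 x))// (le_trans _ xM)// rnorm_ge0.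
Qed.

Variables (h a b : A).
Hypotheses (h0 : positive_elt h) (h1 : rnorm h <= 1).
Hypotheses (a0 : positive_elt a) (a1 : rnorm a <= 1) (b1 : rnorm b <= 1).
Let H := F h.
Let p := F a.
(** [W] is, up to sign, the quantity to be bounded; [X] is the value of the quadratic form at
    [y = a], [c = H], [w = p]. *)
Let W := H * F (a ** b) - p * F b.
Let X := H * F (a ** h ** a) * H - H * F (a ** h) * p - p * F (h ** a) * H + p * H * p.

Let ustarH : ustar H = H.
Proof. by rewrite ustar_emb_map positive_elt_sa. Qed.

Let ustarp : ustar p = p.
Proof. by rewrite ustar_emb_map positive_elt_sa. Qed.

Let bndH : bnd H 1. Proof. exact: bnd_emb_map. Qed.
Let bndp : bnd p 1. Proof. exact: bnd_emb_map. Qed.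

(** At [y = k a + b], [c = H], [w = k p] the form has [X] as coefficient of [|k|^2] and a
    contraction as constant term, so [bnd_discriminant] bounds the linear coefficient [Z], whose
    adjoint is the element in question. *)
Lemma bnd_defect M : 0 < M -> bnd X (M ^+ 2) ->
  bnd (H * F (a ** h ** b) * H - p * F (h ** b) * H) (2 * M).
Proof.
move=> M0 XM; pose Z := H * F (cstar b ** h ** a) * H - H * F (cstar b ** h) * p.
have hs := positive_elt_sa h0; have as_ := positive_elt_sa a0.
have ZE : ustar Z = H * F (a ** h ** b) * H - p * F (h ** b) * H.
  by rewrite /Z ustarB !ustarM ustarH ustarp !ustar_emb_map !cstarM hs as_ cstarK !mulrA cmulA.
rewrite -ZE; apply: bnd_ustar; first by rewrite mulr_ge0// ltW.
apply: (@bnd_discriminant _ _ X (H * F (cstar b ** h ** b) * H)) => //.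
- rewrite /X !(ustarD, ustarN) !ustarM ustarH ustarp !ustar_emb_map !cstarM hs as_ !mulrA cmulA.
  by ncring.
- by rewrite !ustarM ustarH ustar_emb_map !cstarM hs cstarK !mulrA cmulA.
- apply: bndM_contr bndH => //; apply: bnd_contrM bndH _ => //; apply: bnd_emb_map.
  by rewrite !cmul_le1// rnorm_cstar.
move=> k; have := two_positive_quadratic phi2 (k *: a + b) H (k *: p) h0.
rewrite cstarD cstarZ as_ !cmulDl !cmulDr -!cscaleAr -!cscaleAl.
rewrite !(emb_mapD, emb_mapZ) ustarH ustarZ ustarp.
rewrite !(mulrDl, mulrDr, =^~ scalerAr, =^~ scalerAl) !(scalerDr, scalerN, scalerA).
rewrite ZE -/H -/p -/H !scalerBr => pos; congr (upos _): pos; ncring.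
Qed.

Let bndW : bnd W 2.
Proof.
by rewrite -[2]/(1 + 1); apply: bndB; apply: bnd_contrM => //;
   (exact: bndH || exact: bndp || (apply: bnd_emb_map => //; exact: cmul_le1)).
Qed.

Variables (M N e : R).
Hypotheses (M0 : 0 < M) (N0 : 0 < N) (e0 : 0 <= e).
Hypothesis (XM : bnd X (M ^+ 2)).
Hypothesis MN : 4 * (M + e) <= N ^+ 2.
Hypothesis hb : rnorm (h ** b - b) <= e.
Hypothesis hbs : rnorm (h ** cstar b - cstar b) <= e.
Hypothesis hba : rnorm (h ** (cstar b ** a) - cstar b ** a) <= e.

Let bndWH : bnd (W * H) (2 * M + 2 * e).
Proof.
have -> : W * H = (H * F (a ** h ** b) * H - p * F (h ** b) * H) +
    (p * F (h ** b - b) * H - H * F (a ** (h ** b - b)) * H).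
  by rewrite cmulDr cmulNr cmulA !emb_mapB /W; ncring.
apply: bndD; first exact: bnd_defect.
rewrite (_ : 2 * e = e + e); last by rewrite mulrDl mul1r.
have ahb : rnorm (a ** (h ** b - b)) <= e.
  rewrite (le_trans (rnorm_cmul _ _))// -[e]mul1r ler_pM ?rnorm_ge0//.
by apply: bndB; apply: bndM_contr bndH => //; apply: bnd_contrM (bnd_emb_map _).
Qed.

(** The domination of [phi] by [H]: at [y = c], [c = 1], [w = - k W^*] the coefficient of [|k|^2] is
    [W H W^*], which is small because [W H] is, and the linear one is the adjoint of [W F (h c)]. *)
Let bndWF c : rnorm c <= 1 -> bnd (W * F (h ** c)) (2 * N).
Proof.
move=> c1; pose Z := F (cstar c ** h) * ustar W.
have hs := positive_elt_sa h0.
have ZE : ustar Z = W * F (h ** c) by rewrite ustarM ustarK ustar_emb_map cstarM cstarK hs.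
rewrite -ZE; apply: bnd_ustar; first by rewrite mulr_ge0// ltW.
have Ws : ustar (W * H * ustar W) = W * H * ustar W by rewrite !ustarM ustarK ustarH mulrA.
apply: (@bnd_discriminant _ _ (W * H * ustar W) (F (cstar c ** h ** c))) => //.
- by rewrite ustar_emb_map !cstarM hs cstarK cmulA.
- apply: bnd_le MN _; rewrite (_ : 4 * _ = (2 * M + 2 * e) * 2); last by ring.
  apply: bndM; [by rewrite addr_ge0 ?mulr_ge0 ?(ltW M0)|exact: bndWH|].
  by apply: bnd_ustar; [|exact: bndW].
- by apply: bnd_emb_map; rewrite !cmul_le1// rnorm_cstar.
move=> k; have := two_positive_quadratic phi2 c 1 (- (k *: ustar W)) h0.
rewrite ustar1 ustarN ustarZ ustarK !mul1r !mulr1 ZE /Z -/H.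
rewrite !(mulNr, mulrN, opprK, =^~ scalerAr, =^~ scalerAl, scalerA, scalerN) => pos.
congr (upos _): pos; ncring.
Qed.

(** [W^*] is a difference of values of [phi] multiplied on the right by the contractions [H] and
    [p], so [W W^*] is controlled by two products [W F c], each compared with [W F (h c)]. *)
Let bndWW : bnd (W * ustar W) (4 * N + 4 * e).
Proof.
have hs := positive_elt_sa h0; have as_ := positive_elt_sa a0.
have Ws : ustar W = F (cstar b ** a) * H - F (cstar b) * p.
  by rewrite ustarB !ustarM ustarH ustarp !ustar_emb_map cstarM as_.
have key c : rnorm c <= 1 -> rnorm (h ** c - c) <= e -> bnd (W * F c) (2 * N + 2 * e).
  move=> c1 hc; have -> : W * F c = W * F (h ** c) - W * F (h ** c - c).
    by rewrite emb_mapB; ncring.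
  apply: bndB; first exact: bndWF.
  by apply: bndM; [|exact: bndW|exact: bnd_emb_map].
have Ne : 0 <= 2 * N + 2 * e by rewrite addr_ge0// mulr_ge0// ltW.
rewrite Ws mulrBr !mulrA (_ : 4 * N + 4 * e = (2 * N + 2 * e) + (2 * N + 2 * e)); last by ring.
by apply: bndB; apply: bndM_contr => //;
  apply: key; rewrite ?cmul_le1 ?rnorm_cstar.
Qed.

Lemma rnorm_defect_le eps : 0 <= eps -> 4 * N + 4 * e <= eps ^+ 2 ->
  rnorm (phi a ** phi b - phi h ** phi (a ** b)) <= eps.
Proof.
move=> eps0 Ne; rewrite rnorm_distrC; apply/bnd_emb => //.
rewrite embB !embM -/H -/p -/W -[W]ustarK; apply: bnd_ustar => //.
by apply: bnd_cstar => //; rewrite ustarK; apply: bnd_le Ne bndWW.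
Qed.

End Estimate.

Section DefectBound.
Context {R : realType} {A B : cstarAlgType R} (phi : {linear A -> B}).
Hypothesis phi2 : k_positive 2 phi.
Hypothesis phi1 : contractive phi.
Hypothesis phis : forall x, phi (cstar x) = cstar (phi x).
Local Notation F x := (emb (phi x)).
Variables (h a : A) (e d : R).
Hypotheses (h0 : positive_elt h) (h1 : rnorm h <= 1).
Hypotheses (a0 : positive_elt a) (a1 : rnorm a <= 1).
Hypotheses (e0 : 0 <= e) (d0 : 0 <= d).
Hypothesis (ha : rnorm (h ** a - a) <= e).
Hypothesis (pd : rnorm (phi a ** phi a - phi (a ** a) ** phi h) <= d).

(** Removing the inner [h] next to [a] costs [3 e]. With [q = phi (a^2)] there remains
    [(H q - p^2) H - (H p - p H) p], and the commutator of [H] with [p^2] is at most [2 d]. *)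
Lemma bnd_defect_norm n :
  bnd (F h * F (a ** h ** a) * F h - F h * F (a ** h) * F a
       - F a * F (h ** a) * F h + F a * F h * F a)
      (3 * e + (d + (n%:R * d + 4 / n.+2%:R))).
Proof.
have hs := positive_elt_sa h0; have as_ := positive_elt_sa a0.
have H1 : bnd (F h) 1 by exact: bnd_emb_map.
have p1 : bnd (F a) 1 by exact: bnd_emb_map.
have p0 : upos (F a) by apply/positive_eltP/two_positive_map.
have qd : bnd (F a * F a - F (a ** a) * F h) d.
  by rewrite -!embM -embB; apply/bnd_emb.
have qd' : bnd (F h * F (a ** a) - F a * F a) d.
  have := bnd_ustar d0 qd; rewrite ustarB !ustarM !(ustar_emb_map phis) cstarM as_ hs.
  exact: bnd_distrC.
have comm : bnd (F h * F a - F a * F h) (n%:R * d + 4 / n.+2%:R).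
  rewrite (_ : n%:R * d = n%:R * (d + d) / 2); last by field.
  apply: bnd_commutator => //.
  have -> : F h * (F a * F a) - F a * F a * F h =
    F h * (F a * F a - F (a ** a) * F h) + (F h * F (a ** a) - F a * F a) * F h.
    by ncring.
  by apply: bndD; [exact: bnd_contrM|exact: bndM_contr].
have aha : rnorm (a ** (h ** a - a)) <= e.
  by rewrite (le_trans (rnorm_cmul _ _))// -[e]mul1r ler_pM ?rnorm_ge0.
have ah : rnorm (a ** h - a) <= e.
  by rewrite -rnorm_cstar cstarD cstarN cstarM as_ hs.
have -> : F h * F (a ** h ** a) * F h - F h * F (a ** h) * F a
    - F a * F (h ** a) * F h + F a * F h * F a =
  (F h * F (a ** (h ** a - a)) * F h - F h * F (a ** h - a) * F a
    - F a * F (h ** a - a) * F h)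
  + ((F h * F (a ** a) - F a * F a) * F h - (F h * F a - F a * F h) * F a).
  by rewrite cmulDr cmulNr cmulA !emb_mapB; ncring.
have c0 : 0 <= n%:R * d + 4 / n.+2%:R by rewrite addr_ge0 ?mulr_ge0 ?invr_ge0.
apply: bndD; last by apply: bndB; exact: bndM_contr.
rewrite (_ : 3 * e = e + e + e); last by ring.
by apply: bndB; first apply: bndB;
  apply: bndM_contr => //; apply: bnd_contrM => //; exact: bnd_emb_map.
Qed.

End DefectBound.

Lemma almost_order_zero (R : realType) (eps : R) : 0 < eps ->
  exists2 delta : R, 0 < delta &
  forall (A B : cstarAlgType R) (phi : {linear A -> B}) (h a b : A),
    k_positive 2 phi -> contractive phi ->
    (forall x, phi (cstar x) = cstar (phi x)) ->
    positive_elt h -> rnorm h <= 1 -> positive_elt a -> rnorm a <= 1 ->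
    rnorm b <= 1 ->
    rnorm (phi a ** phi a - phi (a ** a) ** phi h) <= delta ->
    rnorm (h ** a - a) <= delta -> rnorm (h ** b - b) <= delta ->
    rnorm (h ** cstar b - cstar b) <= delta ->
    rnorm (h ** (cstar b ** a) - cstar b ** a) <= delta ->
    rnorm (phi a ** phi b - phi h ** phi (a ** b)) <= eps.
Proof.
move=> eps0.
(* The constants are chosen backwards so that [4 N + 4 e <= 8 N = eps^2], [4 (M + e) <= 8 M = N^2]
   and [(n + 4) e + 4 / (n + 2) <= M^2]. The index [n] is fixed before [e], since the commutator
   bound contains [n e]. *)
pose N := eps ^+ 2 / 8; have N0 : 0 < N by rewrite divr_gt0 ?exprn_gt0.
pose M := N ^+ 2 / 8; have M0 : 0 < M by rewrite divr_gt0 ?exprn_gt0.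
have M2 : 0 < M ^+ 2 by rewrite exprn_gt0.
have [n n4] : exists n, 4 / n.+2%:R <= M ^+ 2 / 2.
  exists (Num.bound (8 / M ^+ 2)); set k := Num.bound _.
  have : 8 / M ^+ 2 < k%:R by apply: archi_boundP; rewrite divr_ge0 ?ltW.
  rewrite ltr_pdivrMr// => kM; rewrite ler_pdivrMr ?ltr0n//.
  by rewrite -[k.+2]addn2 natrD; move: M2 kM; nra.
have n40 : 0 < n%:R + 4 :> R by rewrite ltr_wpDl.
pose e := Num.min (Num.min N M) (M ^+ 2 / 2 / (n%:R + 4)).
have e0 : 0 < e by rewrite !lt_min N0 M0 !divr_gt0.
have [eN eM en] : [/\ e <= N, e <= M & (n%:R + 4) * e <= M ^+ 2 / 2].
  by split; rewrite ?[_ * e]mulrC -?ler_pdivlMr// !ge_min lexx ?orbT.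
exists e => // A B phi h a b phi2 phi1 phis h0 h1 a0 a1 b1 pd ha hb hbs hba.
have XM := bnd_defect_norm phi2 phi1 phis h0 h1 a0 a1 (ltW e0) (ltW e0) ha pd n.
apply: (rnorm_defect_le phi2 phi1 phis h0 h1 a0 a1 b1 M0 N0 (ltW e0)) => //.
- apply: bnd_le XM; move: n4; set c := 4 / _ => n4.
  by rewrite mulrDl in en; lra.
- by rewrite [leRHS](_ : _ = 8 * M); [lra|rewrite /M; field].
- exact: ltW.
- by rewrite [leRHS](_ : _ = 8 * N); [lra|rewrite /N; field].
Qed.

(** The identity holds exactly for [h ** y], so the error only involves [phi] at [h ** y - y] and at
    its adjoint. *)
Lemma two_positive_star_limit (R : realType) (A B : cstarAlgType R)
    (phi : {linear A -> B}) (y : A) : k_positive 2 phi ->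
  (exists K, forall x, rnorm (phi x) <= K * rnorm x) ->
  (forall e : R, 0 < e -> exists2 h, positive_elt h & rnorm (h ** y - y) <= e) ->
  phi (cstar y) = cstar (phi y).
Proof.
move=> phi2 [K phiK] yh; apply/eqP; rewrite -subr_eq0; apply/eqP/rnorm0_eq0/le_anti.
rewrite rnorm_ge0 andbT; apply/ler_addgt0Pr => e e0; rewrite add0r.
have K1 : 0 < `|K| + 1 by rewrite ltr_wpDl.
have [h h0 hy] := yh (e / 2 / (`|K| + 1)) (divr_gt0 (divr_gt0 e0 (ltr0n _ 2)) K1).
have bound x : rnorm x <= e / 2 / (`|K| + 1) -> rnorm (phi x) <= e / 2.
  rewrite ler_pdivlMr// => xe; rewrite (le_trans (phiK x))// (le_trans _ xe)//.
  by rewrite mulrC ler_wpM2l ?rnorm_ge0// (le_trans (ler_norm _))// lerDl.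
have hs := positive_elt_sa h0.
have -> : phi (cstar y) - cstar (phi y) =
   - phi (cstar (h ** y - y)) + cstar (phi (h ** y - y)).
  rewrite cstarD cstarN cstarM hs !linearB/= cstarD cstarN.
  by rewrite (two_positive_star phi2 y h0) opprK (addrC (- _)) addrA subrK.
rewrite [e]splitr (le_trans (rnormD _ _))// rnormN rnorm_cstar lerD//.
  by apply: bound; rewrite rnorm_cstar.
exact: bound.
Qed.

(** * Monotone nets and the second dual *)

Section MonotoneNets.
Context {R : realType} {B : cstarAlgType R} {d : Order.disp_t} {L : preorderType d}.
Variable x : L -> B.
Hypothesis Ldir : directed L.
Hypothesis x_incr : forall l m, (l <= m)%O -> positive_elt (x m - x l).
Hypothesis x1 : forall l, rnorm (x l) <= 1.

Lemma net_filter_proper : ProperFilter (net_filter L).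
Proof.
have [[l0 _] Ldir2] := Ldir.
apply: filter_from_proper; last by move=> l _; exists l => /=; exact: Order.le_refl.
apply: filter_from_filter; first by exists l0.
move=> l m _ _; have [n [ln mn]] := Ldir2 l m.
by exists n => // k /= nk; split; [exact: Order.le_trans ln nk|exact: Order.le_trans mn nk].
Qed.

(* Signed sums of increments stay below a single increment in the operator
   order, so a functional cannot oscillate forever along the net. *)
Lemma monotone_net_cauchy (g : B -> R) (K : R) : 0 <= K ->
  (forall u v, g (u + v) = g u + g v) -> (forall u, `|g u| <= K * rnorm u) ->
  forall e : R, 0 < e ->
    exists l, forall m, (l <= m)%O -> `|g (x m) - g (x l)| <= e.
Proof.
move=> K0 gD gK e e0; have [[l0 _] _] := Ldir.
have g0 : g 0 = 0 by apply: (addrI (g 0)); rewrite -gD !addr0.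
have gN u : g (- u) = - g u by apply: (addrI (g u)); rewrite -gD !subrr.
have [//|/forallNP noosc] := pselect (exists l, forall m, (l <= m)%O -> `|g (x m) - g (x l)| <= e).
have {}noosc l : exists2 m, (l <= m)%O & e < `|g (x m) - g (x l)|.
  have /existsNP[m /not_implyP[lm /negP]] := noosc l.
  by rewrite -ltNge => ?; exists m.
(* [S] adds [N] increments with signs making each value of [g] exceed [e], while [S] and [- S] stay
   below [x m - x l0]. That difference has norm at most 2, so [N e <= g S <= 2 K], which fails for
   large [N]. *)
have incr N : exists2 m, (l0 <= m)%O & exists S : B,
    [/\ upos (emb (x m - x l0) - emb S), upos (emb (x m - x l0) + emb S) &
        N%:R * e <= g S].
  elim: N => [|N [m lm [S [mS mS' NS]]]].
    exists l0; first exact: Order.le_refl.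
    by exists 0; rewrite subrr subr0 addr0 mul0r g0; split=> //; exact: upos0.
  have [n mn en] := noosc m; exists n; first exact: Order.le_trans lm mn.
  have Dpos : upos (emb (x n - x m)) by apply/positive_eltP/x_incr.
  have nE : emb (x n - x l0) = emb (x m - x l0) + emb (x n - x m).
    by rewrite -embD; congr emb; rewrite [RHS]addrC addrA subrK.
  move: en; rewrite -gN -gD => en.
  have SD := uposD mS (uposD Dpos Dpos); have SD' := uposD mS' (uposD Dpos Dpos).
  have [gge|glt] := lerP 0 (g (x n - x m)).
    exists (S + (x n - x m)); split.
    - suff -> : emb (x n - x l0) - emb (S + (x n - x m)) = emb (x m - x l0) - emb S by [].
      by rewrite nE (embD S); ncring.
    - suff -> : emb (x n - x l0) + emb (S + (x n - x m)) =
        emb (x m - x l0) + emb S + (emb (x n - x m) + emb (x n - x m)) by [].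
      by rewrite nE (embD S); ncring.
    - rewrite gD -natr1 mulrDl mul1r lerD//.
      by move: en; rewrite ger0_norm// => /ltW.
  exists (S - (x n - x m)); split.
  - suff -> : emb (x n - x l0) - emb (S - (x n - x m)) =
      emb (x m - x l0) - emb S + (emb (x n - x m) + emb (x n - x m)) by [].
    by rewrite nE (embB S); ncring.
  - suff -> : emb (x n - x l0) + emb (S - (x n - x m)) = emb (x m - x l0) + emb S by [].
    by rewrite nE (embB S); ncring.
  - rewrite gD gN -natr1 mulrDl mul1r lerD//.
    by move: en; rewrite ltr0_norm// => /ltW.
have [N NK] : exists N, K * 2 < N%:R * e.
  exists (Num.bound (K * 2 / e)); rewrite -ltr_pdivrMr//.
  by apply: archi_boundP; rewrite divr_ge0 ?mulr_ge0// ltW.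
have [m lm [S [mS mS' NS]]] := incr N.
have x2 : upos (2%:C%C%:A - emb (x m - x l0)).
  have Dpos : upos (emb (x m - x l0)) by apply/positive_eltP/x_incr.
  apply: upos_bound => //; first by case: Dpos.
  by apply/bnd_emb => //; rewrite (le_trans (rnormB _ _))// lerD.
have S2 : rnorm S <= 2.
  apply/bnd_emb => //; apply: upos_bnd => //.
    by rewrite -(subrK (emb (x m - x l0)) 2%:C%C%:A) -addrA; exact: uposD.
  by rewrite -(subrK (emb (x m - x l0)) 2%:C%C%:A) -addrA; exact: uposD.
have := le_trans NS (le_trans (ler_norm _) (gK S)).
have : K * rnorm S <= K * 2 by rewrite ler_wpM2l.
lra.
Qed.

Lemma dual_monotone_net_cauchy (f : dual B) :
  rcauchy (net_filter L) (fun l => f (x l)).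
Proof.
move=> e e0; have [_ Ldir2] := Ldir.
(* Real and imaginary parts are each compared through an intermediate index: four errors. *)
have e4 : 0 < e / 4 by rewrite divr_gt0.
have ReD (k k' : R[i]) : complex.Re (k + k') = complex.Re k + complex.Re k'.
  by case: k; case: k'.
have ImD (k k' : R[i]) : complex.Im (k + k') = complex.Im k + complex.Im k'.
  by case: k; case: k'.
have Re_add u v : complex.Re (f (u + v)) = complex.Re (f u) + complex.Re (f v).
  by rewrite -ReD linearD.
have Im_add u v : complex.Im (f (u + v)) = complex.Im (f u) + complex.Im (f v).
  by rewrite -ImD linearD.
have [l Re_l] := monotone_net_cauchy (rnorm_ge0 f) Re_add
  (fun u => le_trans (Re_le_rnorm _) (rnorm_dualP _ _)) e4.
have [m Im_m] := monotone_net_cauchy (rnorm_ge0 f) Im_add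
  (fun u => le_trans (Im_le_rnorm _) (rnorm_dualP _ _)) e4.
have [n [ln mn]] := Ldir2 l m.
exists [set k | (n <= k)%O]; first by exists n.
move=> s t /= ns nt; rewrite (le_trans (rnorm_ReIm _))//.
have ReB (k k' : R[i]) : complex.Re (k - k') = complex.Re k - complex.Re k'.
  by case: k; case: k'.
have ImB (k k' : R[i]) : complex.Im (k - k') = complex.Im k - complex.Im k'.
  by case: k; case: k'.
rewrite ReB ImB.
have := Re_l s (Order.le_trans ln ns); have := Re_l t (Order.le_trans ln nt).
have := Im_m s (Order.le_trans mn ns); have := Im_m t (Order.le_trans mn nt).
rewrite (distrC (complex.Re (f (x t)))) (distrC (complex.Im (f (x t)))).
move=> It Is Rt Rs.
have RT := ler_distD (complex.Re (f (x l))) (complex.Re (f (x s))) (complex.Re (f (x t))).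
have IT := ler_distD (complex.Im (f (x m))) (complex.Im (f (x s))) (complex.Im (f (x t))).
lra.
Qed.

(** The pointwise limit on functionals is linear, and it has norm at most 1 because the net lies in
    the unit ball. *)
Lemma monotone_net_weak_star_limit :
  exists F : bidual B, weak_star_limit (fun l => to_bidual (x l)) F.
Proof.
have PF := net_filter_proper.
have cv (f : dual B) : exists k : R[i]^o, f (x l) @[l --> net_filter L] --> k.
  by have [k /rcvgP] := complex_cauchy_cvg PF (dual_monotone_net_cauchy f); exists k.
pose psi f := sval (cid (cv f)).
have psiP (f : dual B) : f (x l) @[l --> net_filter L] --> psi f := svalP (cid (cv f)).
have psi_dual : psi \in @dual_pred R (dual B).
  apply: dual_predP => [k f g|].
    apply: (@cvg_unique _ _ _ _ _ _ (psiP _)) => //.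
    by apply: cvgD (psiP g); apply: cvgZl_tmp; exact: psiP.
  exists 1 => f; rewrite mul1r; apply/ler_addgt0Pr => e e0.
  have /rcvgP /(_ e e0) /filter_ex[l /= le] := psiP f.
  rewrite -(subrK (f (x l)) (psi f)) (le_trans (rnormD _ _))// addrC lerD//.
  rewrite (le_trans (rnorm_dualP _ _))// -[leRHS]mulr1 ler_wpM2l ?rnorm_ge0//.
by exists (Dual psi_dual) => f; exact: psiP.
Qed.

End MonotoneNets.

Lemma net_limsup_lt (R : realType) (d : Order.disp_t) (L : preorderType d)
    (x : L -> R) (c : R) : (net_limsup x < c%:E)%E ->
  exists l, forall m, (l <= m)%O -> x m <= c.
Proof.
move=> /ereal_inf_lt[_ [l _ <-] lc]; exists l => m lm.
rewrite -lee_fin (le_trans _ (ltW lc))//.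
by apply: ereal_sup_ubound; exists m.
Qed.

Section ApproximateUnit.
Context {R : realType} {A : cstarAlgType R} {d : Order.disp_t} {L : preorderType d}.
Variable h : L -> A.
Hypothesis hA : approximate_unit h.

Lemma approximate_unit_near (y : A) (e : R) : 0 < e ->
  net_filter L [set l | rnorm (h l ** y - y) <= e].
Proof.
move=> e0; have [Ldir _ _ /(_ y) hy] := hA.
have PF := net_filter_proper Ldir.
have /cvgrPdist_le/(_ e e0) := hy.
by apply: filterS => l /=; rewrite sub0r normrN ger0_norm// rnorm_ge0.
Qed.

End ApproximateUnit.

(** This makes right multiplication by an element of [B] weak*-continuous: the product at [f] is the
    value of [F] at one functional independent of [F]. *)
Lemma arens_to_bidualE (R : realType) (B : cstarAlgType R) (F : bidual B) (y : B)
    (f : dual B) : exists g : dual B,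
  arens F (to_bidual y) f = F g /\ forall z, g z = f (z ** y).
Proof. by exists (bidual_act (to_bidual y) f). Qed.

(** Each functional in the unit ball sees the Arens product as the limit of its values at
    [x l ** z], so a norm bound valid along the net passes to the limit. *)
Lemma rnorm_bidual_limit (R : realType) (B : cstarAlgType R)
    (d : Order.disp_t) (L : preorderType d) (x : L -> B) (F : bidual B)
    (y z : B) (e : R) : directed L -> 0 <= e ->
  weak_star_limit (fun l => to_bidual (x l)) F ->
  net_filter L [set l | rnorm (y - x l ** z) <= e] ->
  rnorm (to_bidual y - arens F (to_bidual z)) <= e.
Proof.
move=> Ldir e0 xF near_e; have PF := net_filter_proper Ldir.
apply: rnorm_dual_le => f f1.
have [g [FzE gE]] := arens_to_bidualE F z f.
apply/ler_addgt0Pr => r r0.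
have /rcvgP/(_ r r0) xg := xF g.
have [l [/= le lr]] := filter_ex (filterI near_e xg).
rewrite [X in rnorm X](_ : _ = f (y - x l ** z) - (F g - g (x l))); last first.
  by rewrite linearB/= -gE opprB addrA subrK -FzE.
rewrite (le_trans (rnormB _ _))// lerD//.
rewrite (le_trans (rnorm_dualP _ _))// -[e]mul1r ler_pM ?rnorm_ge0//.
Qed.

(** * 2-positive maps on a unital algebra *)

Section UnitalDomain.
Context {R : realType} {A B : cstarAlgType R} (phi : {linear A -> B}) (e : A).
Hypothesis e1 : is_unity e.
Hypothesis phi2 : k_positive 2 phi.
Local Notation F x := (emb (phi x)).

Lemma unity_star : cstar e = e.
Proof.
have eE : e ** cstar e = cstar e by case: (e1 (cstar e)).
by rewrite -[RHS]cstarK -{2}eE cstarM cstarK eE.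
Qed.

Lemma unity_positive : positive_elt e.
Proof. by exists e; rewrite unity_star; case: (e1 e). Qed.

Lemma unity_rnorm : rnorm e <= 1.
Proof.
apply: sqr_le_rnorm => //.
by rewrite -rnorm_cstar_mul unity_star; case: (e1 e) => -> _; rewrite mul1r.
Qed.

Lemma unital_two_positive_star y : phi (cstar y) = cstar (phi y).
Proof.
have := two_positive_star phi2 y unity_positive.
by case: (e1 y) => -> _; case: (e1 (cstar y)) => _ ->.
Qed.

(** For [|y| <= 1], [y^* y <= e] bounds [phi (y^* y)] by [phi e]; the quadratic form at [h = e] with
    [bnd_discriminant] then bounds [phi y] itself. *)
Lemma unital_two_positive_bounded :
  exists2 M : R, 0 < M & forall y, rnorm (phi y) <= M * rnorm y.
Proof.
(* The added 1 gives [K <= K^2] and [1 / K <= 1], as the hypotheses of the discriminant bound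
   require. *)
pose K := rnorm (phi e) + 1; have K1 : 1 <= K by rewrite lerDr rnorm_ge0.
have K0 : 0 < K := lt_le_trans ltr01 K1.
have Fe : bnd (F e) K by apply/bnd_emb; rewrite ?(ltW K0)// lerDl.
have es : ustar (emb e) = emb e by rewrite -emb_star unity_star.
have yy1 y : rnorm y <= 1 -> bnd (F (cstar y ** y)) K.
  move=> y1; apply: (uposB_bnd (Q := F e)) => //; first exact: ltW.
    by apply/positive_eltP/two_positive_map => //; exists y.
  rewrite -embB -linearB; apply/positive_eltP/two_positive_map => //.
  (* [e] is only a projection in the unitization, so [1 - y^* y] is compressed by it. *)
  apply/positive_eltP; have -> : emb (e - cstar y ** y) =
      ustar (emb e) * (1 - emb (cstar y ** y)) * emb e.
    rewrite es mulrBr mulrBl mulr1 -!embM -embB.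
    by case: (e1 (cstar y ** y)) => -> ->; case: (e1 e) => ->.
  apply: upos_conj; rewrite -[1]scale1r; apply: upos_bound => //.
    by rewrite -emb_star cstarM cstarK.
  by apply/bnd_emb => //; rewrite rnorm_cstar_mul exprn_ile1// rnorm_ge0.
pose s := K^-1; have s0 : 0 < s by rewrite invr_gt0.
have unit_ball y : rnorm y <= 1 -> rnorm (phi y) <= 2 * K ^+ 2.
  move=> y1; rewrite -rnorm_cstar -unital_two_positive_star.
  apply/bnd_emb; first by rewrite mulr_ge0// sqr_ge0.
  have Zb : bnd (s%:C%C *: F (cstar y)) (2 * K).
    apply: (@bnd_discriminant _ _ (F e) ((s ^+ 2)%:C%C *: F (cstar y ** y))) => //.
    - by rewrite -emb_star -unital_two_positive_star unity_star.
    - by rewrite ustarZr -emb_star -unital_two_positive_star cstarM cstarK.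
    - by apply: bnd_le Fe; rewrite expr2 ler_peMl// ltW.
    - apply: (@bnd_le _ _ _ (`|s ^+ 2| * K)); last by apply: bndZr; exact: yy1.
      by rewrite ger0_norm ?sqr_ge0// expr2 -mulrA mulVf ?mulr1 ?invf_le1// gt_eqF.
    move=> k; have := two_positive_quadratic phi2 y (s%:C%C%:A) (- (k *: 1)) unity_positive.
    case: (e1 y) => -> _; case: (e1 (cstar y)) => _ ->.
    have wE : ustar (- (k *: 1) : unitization B) = - ((k^*)%C *: 1).
      by rewrite ustarN ustarZ ustar1.
    rewrite ustar_real wE ustarZr -emb_star -unital_two_positive_star cstarK.
    rewrite !(mulNr, mulrN, opprK, =^~ scalerAr, =^~ scalerAl, scalerA, scalerN, mul1r, mulr1).
    rewrite (mulrC s%:C%C (k^*)%C) (expr2 s) rmorphM/= => pos.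
    by congr (upos _): pos; ncring.
  rewrite -[F _]scale1r.
  have -> : (1 : R[i]) = K%:C%C * s%:C%C by rewrite -rmorphM/= mulfV// gt_eqF.
  apply: (@bnd_le _ _ _ (`|K| * (2 * K))); last by rewrite -scalerA; exact: bndZr.
  by rewrite gtr0_norm// mulrCA expr2.
exists (2 * K ^+ 2) => [|y]; first by rewrite mulr_gt0// exprn_gt0.
have [->|/rnorm_gt0 y0] := eqVneq y 0; first by rewrite linear0 !rnorm0 mulr0.
have := unit_ball (((rnorm y)^-1)%:C%C *: y).
rewrite linearZ/= !rnormZr ger0_norm ?invr_ge0 ?rnorm_ge0// mulVf ?gt_eqF//.
by move=> /(_ (lexx _)); rewrite ler_pdivrMl// mulrC.
Qed.

(** Scaling makes the map and the arguments contractive and preserves the identity. With [h = e] all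
    errors in [almost_order_zero] vanish, so its bound holds for every [eps], and [a b = 0] leaves
    only the product of the images. *)
Lemma order_zero_of_square_identity :
  (forall a : A, positive_elt a -> phi a ** phi a = phi (a ** a) ** phi e) ->
  order_zero phi.
Proof.
move=> sqr; split; first exact: two_positive_map.
have [M M0 phiM] := unital_two_positive_bounded.
pose c := (M^-1)%:C%C : R[i].
have c0 : c != 0 by rewrite (inj_eq (@complexI R) _ 0) invr_eq0 gt_eqF.
pose psi := c \*: phi : {linear A -> B}.
have psi1 : contractive psi.
  move=> y; rewrite /= rnormZr ger0_norm ?invr_ge0 ?(ltW M0)//.
  by rewrite ler_pdivrMl.
have psi2 : k_positive 2 psi.
  (* The factor [1 / M] is split as a square root on each side of the Gram factorization. *)
  move=> x /phi2[z xz]; exists (map_mx ( *:%R (Num.sqrt M^-1)%:C%C) z).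
  apply/matrixP => i j; rewrite [LHS]mxE /=.
  have -> : phi (x i j) = \sum_(l < 2) mxcstar z i l ** z l j.
    by have := congr1 (fun N : 'M[B]_2 => N i j) xz; rewrite !mxE.
  rewrite [RHS]mxE scaler_sumr; apply: eq_bigr => l _; rewrite !mxE cstarZ.
  rewrite -cscaleAl -cscaleAr scalerA; congr (_ *: _).
  have -> : ((Num.sqrt M^-1)%:C%C^*)%C = (Num.sqrt M^-1)%:C%C :> R[i].
    by apply/eqP; rewrite eq_complex/= oppr0 !eqxx.
  by rewrite -rmorphM/= -expr2 sqr_sqrtr// invr_ge0 ltW.
have psis y : psi (cstar y) = cstar (psi y).
  by rewrite /= unital_two_positive_star cstarZ; congr (_ *: _);
     apply/eqP; rewrite eq_complex/= oppr0 !eqxx.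
have psi_sqr y : positive_elt y -> psi y ** psi y = psi (y ** y) ** psi e.
  by move=> y0; rewrite /= -!(cscaleAl, cscaleAr) sqr.
have unit_ball (y : A) : exists2 r : R, 0 < r & rnorm (r%:C%C *: y) <= 1.
  have y1 : 0 < rnorm y + 1 by rewrite ltr_wpDl ?rnorm_ge0.
  exists (rnorm y + 1)^-1; first by rewrite invr_gt0.
  by rewrite rnormZr ger0_norm ?invr_ge0 ?(ltW y1)// ler_pdivrMl// mulr1 lerDl.
move=> a b a0 b0 ab; have [r r0 ra] := unit_ball a; have [s s0 sb] := unit_ball b.
have rs0 (t : R) : 0 < t -> t%:C%C != 0 :> R[i].
  by move=> t0; rewrite (inj_eq (@complexI R) _ 0) gt_eqF.
have ra0 : positive_elt (r%:C%C *: a).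
  by apply/positive_eltP; rewrite embZ; apply: uposZ (ltW r0) _; exact/positive_eltP.
suff : psi (r%:C%C *: a) ** psi (s%:C%C *: b) = 0.
  rewrite /= !linearZ/= -!(cscaleAl, cscaleAr) => /eqP.
  by rewrite !scaler_eq0 !(negPf c0) !(negPf (rs0 _ _))//= => /eqP.
apply: rnorm0_eq0; apply/le_anti; rewrite rnorm_ge0 andbT.
apply/ler_addgt0Pr => eps eps0; rewrite add0r.
have [delta delta0 core] := almost_order_zero eps0.
have eE y : rnorm (e ** y - y) <= delta by case: (e1 y) => -> _; rewrite subrr rnorm0 ltW.
have := core _ _ psi e _ _ psi2 psi1 psis unity_positive unity_rnorm ra0 ra sb.
have -> : (r%:C%C *: a) ** (s%:C%C *: b) = 0.
  by rewrite -cscaleAl -cscaleAr ab !scaler0.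
rewrite linear0 cmul0r subr0; apply=> //.
by rewrite psi_sqr// subrr rnorm0 ltW.
Qed.

End UnitalDomain.

Theorem theorem1p1 (R : realType) :
  (forall eps : R, 0 < eps ->
   exists2 delta : R, 0 < delta &
   forall (A B : cstarAlgType R) (d : Order.disp_t) (L : preorderType d)
     (h : L -> A) (phi : {linear A -> B}) (a : A),
   approximate_unit h -> k_positive 2 phi -> contractive phi ->
   positive_elt a -> rnorm a <= 1 ->
   (net_limsup (fun l => rnorm (phi a ** phi a - phi (a ** a) ** phi (h l))%R)
      < delta%:E)%E ->
   exists2 hphi : bidual B,
     weak_star_limit (fun l => to_bidual (phi (h l))) hphi &
     (ereal_sup
        [set (rnorm (to_bidual (phi a ** phi b)
                     - arens hphi (to_bidual (phi (a ** b))))%R)%:E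
         | b in [set b : A | (rnorm b <= 1)%R]] < eps%:E)%E) /\
  (forall (A B : cstarAlgType R) (e : A) (phi : {linear A -> B}),
   is_unity e -> k_positive 2 phi ->
   (forall a : A, positive_elt a -> phi a ** phi a = phi (a ** a) ** phi e) ->
   order_zero phi).
Proof.
split=> [eps eps0|A B e phi e1 phi2 sqr]; last first.
  exact: (order_zero_of_square_identity e1).
(* Half of [eps], since a supremum of quantities below a bound need not be strictly below it. *)
have eps2 : 0 < eps / 2 by rewrite divr_gt0.
have [delta delta0 core] := almost_order_zero eps2.
exists delta => // A B d L h phi a hA phi2 phi1 a0 a1 lim_a.
have [Ldir h_incr h_ball _] := hA.
have PF := net_filter_proper Ldir.
have phis y : phi (cstar y) = cstar (phi y).
  apply: two_positive_star_limit => //.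
    by exists 1 => x; rewrite mul1r.
  move=> e e0; have [l hl] := filter_ex (approximate_unit_near hA y e0).
  by exists (h l) => //; case: (h_ball l).
have [hphi hphiP] : exists F : bidual B, weak_star_limit (fun l => to_bidual (phi (h l))) F.
  apply: monotone_net_weak_star_limit => // [l m lm|l].
    by rewrite -linearB; apply: two_positive_map => //; exact: h_incr.
  by case: (h_ball l) => _; apply: le_trans; exact: phi1.
exists hphi => //; apply: (@le_lt_trans _ _ (eps / 2)%:E); last first.
  by rewrite lte_fin ltr_pdivrMr// ltr_pMr// ltr1n.
apply: ge_ereal_sup => _ [b /= b1 <-]; rewrite lee_fin.
apply: (rnorm_bidual_limit Ldir (ltW eps2) hphiP).
have [l0 hl0] := net_limsup_lt lim_a.
have near_a : net_filter L [set l | rnorm (phi a ** phi a - phi (a ** a) ** phi (h l)) <= delta].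
  by exists l0.
have near y := approximate_unit_near hA y delta0.
apply: filterS (filterI near_a (filterI (near a) (filterI (near b)
  (filterI (near (cstar b)) (near (cstar b ** a)))))) => l /= [la [ha [hb [hbs hba]]]].
by have [hl hl1] := h_ball l; exact: core.
Qed.
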